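(* Let $W$ be a complete discrete valuation ring with finite residue field of cardinality $q$, let $d\ge1$, and let $(A,B)$ be a random pair of monic polynomials of degree $d$ over $W$ distributed according to the Haar probability measure. Fix $j\in\{0,\dots,d-1\}$ and let $V_j$ be the valuation of the $j$-th principal subresultant of $(A,B)$. Let $X_0,\dots,X_{d-1}$ be mutually independent random variables with geometric law of parameter $1-q^{-1}$, i.e. $\mathbb P[X_i=k]=(1-q^{-1})q^{-k}$ for $k\in\mathbb N$, and set $X_i=+\infty$ for $i<0$ and $X_i=0$ for $i\ge d$. Then $V_j$ has the same distribution as $$Y_j=\sum_{i=0}^{d}\min(X_{j-i},X_{j-i+1},\dots,X_{j+i}).$$
   Context: The set of pairs of monic degree-$d$ polynomials over $W$ is identified with $W^{2d}$ via the non-leading coefficients and endowed with the product of the Haar probability measures on $W$. The $j$-th principal subresultant $r_j$ of $(A,B)$ (computed in degree $(d,d)$) is the determinant of the square matrix of size $2(d-j)$ whose columns are the coefficient vectors of $X^{d-j-1}A,\dots,A,X^{d-j-1}B,\dots,B$ restricted to the monomials $X^{2d-j-1},\dots,X^{j}$; its valuation is $+\infty$ if it vanishes. *)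

(* Defs.v *)
From HB Require Import structures.
From mathcomp Require Export all_boot all_order all_algebra.
From mathcomp Require Export all_classical all_reals all_analysis.
From mathcomp Require Export measurable_realfun.

Set Implicit Arguments.
Unset Strict Implicit.
Unset Printing Implicit Defensive.

Import Order.TTheory GRing.Theory Num.Theory.

Local Open Scope classical_set_scope.
Local Open Scope ring_scope.

Section Ideals.
Variable W : idomainType.

Definition is_ideal (I : set W) : Prop :=
  [/\ I 0, (forall x y, I x -> I y -> I (x + y)) & (forall a x, I x -> I (a * x))].

Definition ideal_span (S : set W) : set W :=
  \bigcap_(I in [set I | is_ideal I /\ S `<=` I]) I.

Definition ideal_mul (I J : set W) : set W :=
  ideal_span [set a * b | a in I & b in J].

Fixpoint ideal_pow (I : set W) (n : nat) : set W :=
  if n is n'.+1 then ideal_mul I (ideal_pow I n') else setT.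

Definition nonunits : set W := [set x | x \isn't a GRing.unit].

(* A principal ideal domain that is local (its nonunits form an ideal, which is
   then its unique maximal ideal) and is not a field. *)
Definition is_dvr : Prop :=
  [/\ (forall I, is_ideal I -> exists a, I = [set a * x | x in setT]),
      is_ideal nonunits
    & exists2 x, x != 0 & nonunits x].

Definition adic_cauchy (u : nat -> W) : Prop :=
  forall n, exists N, forall k l, (N <= k)%N -> (N <= l)%N ->
    ideal_pow nonunits n (u k - u l).

Definition adic_cvg (u : nat -> W) (x : W) : Prop :=
  forall n, exists N, forall k, (N <= k)%N -> ideal_pow nonunits n (u k - x).

Definition adic_complete : Prop :=
  forall u, adic_cauchy u -> exists x, adic_cvg u x.

(* The underlying set of the residue field, as the set of cosets of the maximal
   ideal. *)
Definition residue_field : set (set W) :=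
  range (fun x => [set y | nonunits (y - x)]).

Definition adic_open : set (set W) :=
  [set U | forall x, U x -> exists n, forall y, ideal_pow nonunits n (y - x) -> U y].

Definition valuation (R : realType) (x : W) : \bar R :=
  ereal_sup [set (n%:R)%:E | n in [set n | ideal_pow nonunits n x]].

End Ideals.

Arguments residue_field W : clear implicits.

(* g_sigma_algebraType needs a pointedType, a structure that idomainTypes do not
   inherit. *)
Definition pointed_ring (W : idomainType) : Type := W.

HB.instance Definition _ (W : idomainType) := Choice.copy (pointed_ring W) W.
HB.instance Definition _ (W : idomainType) :=
  isPointed.Build (pointed_ring W) (0 : W).

Notation borel W :=
  (g_sigma_algebraType (@adic_open W : set (set (pointed_ring W)))).

Definition is_haar (W : idomainType) (R : realType)
    (mu : probability (borel W) R) : Prop :=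
  forall (x : W) (S : set W), measurable (S : set (borel W)) ->
    mu [set x + y | y in S] = mu S.

Section Subresultant.
Variable W : idomainType.

(* With e = d - j, the columns of the left (resp. right) block hold the
   coefficients of X^(e-1) A, ..., A (resp. X^(e-1) B, ..., B), and the rows
   correspond to the monomials X^(2d-j-1), ..., X^j. *)
Definition subresultant_mx (d j : nat) (A B : {poly W}) :
    'M[W]_((d - j) + (d - j)) :=
  let block (p : {poly W}) : 'M[W]_((d - j) + (d - j), d - j) :=
    \matrix_(r, c) ('X^((d - j).-1 - c) * p)`_((d + d - j).-1 - r) in
  row_mx (block A) (block B).

Definition subresultant (d j : nat) (A B : {poly W}) : W :=
  \det (subresultant_mx d j A B).

End Subresultant.

Section RandomPair.
Context (W : idomainType) (R : realType) (dO : measure_display).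
Context (Omega : measurableType dO).

Definition pair_coefs (d : nat) (A B : {poly W}) : (d + d).-tuple (borel W) :=
  [tuple match fintype.split i with inl k => A`_k | inr k => B`_k end | i < d + d].

(* The last clause says that the law of the random vector of the 2d non-leading
   coefficients is the product measure mu^(2d), which is determined by its
   values on measurable boxes. *)
Definition haar_monic_pair (d : nat) (mu : probability (borel W) R)
    (P : probability Omega R) (A B : Omega -> {poly W}) : Prop :=
  [/\ (forall w, A w \is monic /\ size (A w) = d.+1),
      (forall w, B w \is monic /\ size (B w) = d.+1),
      measurable_fun setT (fun w => pair_coefs d (A w) (B w))
    & forall S : 'I_(d + d) -> set (borel W), (forall i, measurable (S i)) ->
        P [set w | forall i, S i (tnth (pair_coefs d (A w) (B w)) i)] =
        (\prod_i mu (S i))%E].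

End RandomPair.

Section Laws.
Context (R : realType) (dO : measure_display) (Omega : measurableType dO).

Definition mutually_independent (I : finType) (P : probability Omega R)
    (X : I -> {RV P >-> nat}) : Prop :=
  forall (J : {set I}) (S : I -> set nat),
    P (\bigcap_(i in [set` J]) (X i @^-1` S i)) =
    (\prod_(i in J) P (X i @^-1` S i))%E.

Definition geometric_law (P : probability Omega R) (q : nat)
    (X : {RV P >-> nat}) : Prop :=
  forall k : nat,
    P [set w | X w = k] = ((1 - q%:R^-1) * q%:R^-1 ^+ k)%:E.

Definition same_law (dO' : measure_display) (Omega' : measurableType dO')
    (P : probability Omega R) (P' : probability Omega' R)
    (V : Omega -> \bar R) (Y : Omega' -> \bar R) : Prop :=
  [/\ measurable_fun setT V, measurable_fun setT Y
    & forall S, measurable S -> P (V @^-1` S) = P' (Y @^-1` S)].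

Definition extend_family (d : nat) (X : 'I_d -> Omega -> nat) (i : int)
    (w : Omega) : \bar R :=
  match i with
  | Negz _ => +oo%E
  | Posz n => if insub n is Some k then ((X k w)%:R)%:E else 0%E
  end.

Definition sum_of_mins (d j : nat) (X : 'I_d -> Omega -> nat) (w : Omega) :
    \bar R :=
  (\sum_(i < d.+1)
     \big[Order.min/+oo]_(k < (i + i).+1)
        extend_family X (j%:Z - i%:Z + k%:Z)%R w)%E.

End Laws.

(* Main.v *)
(* Modulo [pi^n] the statement is a count over the finite chain ring [W / pi^N],
   [n <= N].  Writing [C = B - A], the [j]-th subresultant is, up to sign, the
   Hankel determinant of size [e = d - j] of the coefficients [h_1, h_2, ...] of
   [C / A] in powers of [X^-1].  Split according to the index [s] of the first
   unit among the [h_i].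

   If [s <= e], then [A = Q A' - Q0 C'] and [C = F A' - F0 C'] with [Q0 F - Q F0 = 1],
   [Q] monic of degree [s] and [F] congruent to a unit constant.  The Hankel matrix
   of [(A, C)] is congruent to the direct sum of an invertible block and the Hankel
   matrix of [(A', C')], and [(Q, F, A', C') |-> (A, C)] is injective between sets
   of the same cardinality: the conditional law is that of [(A', C')], of degree
   [d - s].  If [s > e], the vector [(h_1, ..., h_(2e-1))] is uniform given [s], and
   the same step applied to the reversed vector, now with [Q] congruent to a power
   of [X], leaves [pi] times a uniform Hankel matrix of size [s - e].  If there is
   no unit at all, [C = pi C1] with [C1] uniform.

   Subtracting the resulting recursions for [(d, e)] and [(d - 1, e - 1)] leaves
   a two-term recursion for the tails [p_(d,e)(n)] of [V_j] when [d <= 2 e - 1]: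
     p_(d,e)(n) - p_(d-1,e-1)(n) = q^-d (p_(d,e)(n-e) - p_(d-1,e-1)(n-e+1)),
   while [p_(d,e)] does not depend on [d] when [d >= 2 e - 1].  The tails of [Y_j]
   satisfy the same relations: [Y_j] for [(d, e)] is [Y_j] for [(d - 1, e - 1)] plus
   the minimum of all the variables, and geometric variables are memoryless. *)

(* Over [W / pi^N] leading coefficients may be nilpotent, so the Euclidean algorithm cannot be run
   forward on [(A, C)]. Each step is built backwards, and no preimage is ever constructed:
   injectivity and a count give the bijection. Congruences modulo [pi] stay in the same ring:
   multiplication by [pi^(N-1)] kills exactly the multiples of [pi], so they become equalities of
   scaled polynomials.

   The Hankel matrix is the Gram matrix of a bilinear form on polynomials of degree less than [e],
   which is why a change of polynomial basis splits off a block. When [d < 2e - 1], its last entries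
   depend on the first [d] through [A]. They are still uniform once a late first unit is fixed: that
   unit is the pivot of a system, triangular modulo [pi], that solves for as many coefficients of
   [A].

   The law conditioned on [s] depends only on [d - s] and [e - s], so the sum for [(d - 1, e - 1)]
   reappears in that for [(d, e)], times [q^-1]. On the other side, a geometric variable capped at
   [N] is the valuation of a uniform element of the same ring: the tails of [Y_j] become counts in
   that ring too. *)
From HB Require Import structures.
Require Import Defs.
From mathcomp Require Import perm ring lra zify.

Set Implicit Arguments.
Unset Strict Implicit.
Unset Printing Implicit Defensive.

Import Order.TTheory GRing.Theory Num.Theory.
Import Pdiv.CommonRing Pdiv.RingMonic.
Local Open Scope ring_scope.

(** * Residues and Hankel determinants *)

(* [size p] may occur through several coercion paths from the structure of the
   coefficient ring, which [lia] does not identify. *)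
Ltac plia :=
  repeat match goal with
  | H : is_true _ |- _ => revert H
  | H : @eq nat _ _ |- _ => revert H
  end;
  repeat match goal with
  | |- context [@size ?T (@polyseq ?S ?p)] =>
    let n := fresh "n" in move: (@size T (@polyseq S p)) => n
  end; lia.

Section Residue.
Variable R : comNzRingType.
Implicit Types A B C F Q p : {poly R}.

(* The coefficient of [X^-1] in the expansion of [p / A] in powers of [X^-1]. *)
Definition residue A p : R := (rmodp p A)`_(size A).-2.

Lemma residueD A p1 p2 : A \is monic ->
  residue A (p1 + p2) = residue A p1 + residue A p2.
Proof. by move=> Am; rewrite /residue rmodpD // coefD. Qed.

Lemma residueZ A a p : A \is monic -> residue A (a *: p) = a * residue A p.
Proof. by move=> Am; rewrite /residue rmodpZ // coefZ. Qed.

Lemma residue_sum A (I : Type) (r : seq I) (f : I -> {poly R}) : A \is monic ->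
  residue A (\sum_(i <- r) f i) = \sum_(i <- r) residue A (f i).
Proof. by move=> Am; rewrite /residue rmodp_sum // coef_sum. Qed.

Lemma residue_mull A z : A \is monic -> residue A (z * A) = 0.
Proof. by move=> Am; rewrite /residue rmodp_mull // coef0. Qed.

Lemma residue_addl_mul A z p : A \is monic ->
  residue A (z * A + p) = residue A p.
Proof. by move=> Am; rewrite residueD // residue_mull // add0r. Qed.

Lemma residue_small d A p : size A = d.+1 -> (size p <= d)%N ->
  residue A p = p`_d.-1.
Proof. by move=> sA sp; rewrite /residue rmodp_small ?sA. Qed.

Lemma residue_small0 d A p : size A = d.+1 -> (size p <= d.-1)%N ->
  residue A p = 0.
Proof.
move=> sA sp; rewrite (residue_small sA) ?nth_default //.
by rewrite (leq_trans sp) ?leq_pred.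
Qed.

Lemma residue_rmod A p z : A \is monic ->
  residue A (z * rmodp p A) = residue A (z * p).
Proof. by move=> Am; rewrite /residue rmodp_mulmr. Qed.

(** The fractions [p / A] and [(p * B) / (A * B)] have the same expansion. Once [p] is reduced to
    [r] modulo [A], [r * B] is reduced modulo [A * B], and [B] is monic, so only top coefficients
    need comparing. *)
Lemma residue_cancel A B p : A \is monic -> B \is monic ->
  residue (A * B) (p * B) = residue A p.
Proof.
move=> Am Bm.
have sB : (0 < size B)%N by rewrite size_poly_gt0 monic_neq0.
have sA : (0 < size A)%N by rewrite size_poly_gt0 monic_neq0.
rewrite [in LHS](rdivp_eq Am p) mulrDl -mulrA residue_addl_mul ?rpredM //.
rewrite [RHS]/residue; have := ltn_rmodpN0 p (monic_neq0 Am).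
move: (rmodp p A) => r rA; have [->|rn0] := eqVneq r 0.
  by rewrite mul0r /residue rmod0p !coef0.
have sAB : size (A * B) = ((size A).-1 + (size B).-1).+1.
  by rewrite size_Mmonic ?monic_neq0 //; plia.
have srB : size (r * B) = (size r + (size B).-1)%N.
  by rewrite size_Mmonic //; plia.
have [sr|sr] := eqVneq (size r) (size A).-1.
  rewrite (residue_small sAB) ?srB; last by plia.
  have := lead_coef_Mmonic r Bm; rewrite !lead_coefE srB sr => <-.
  by congr (_`_ _); plia.
rewrite (residue_small0 sAB) ?srB; last by plia.
by rewrite nth_default //; plia.
Qed.

(* [moment A C i] is the coefficient of [X^-(i+1)] in the expansion of [C / A]. *)
Definition moment A C (i : nat) : R := residue A ('X^i * C).

Definition hankel (e : nat) (h : nat -> R) : 'M[R]_e := \matrix_(i, k) h (i + k)%N.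

Lemma eq_hankel e (h g : nat -> R) :
  (forall i, (i < (e + e).-1)%N -> h i = g i) -> hankel e h = hankel e g.
Proof.
move=> hg; apply/matrixP => i k; rewrite !mxE hg //.
by have := ltn_ord i; have := ltn_ord k; plia.
Qed.

Lemma poly_expand e p : (size p <= e)%N -> p = \sum_(i < e) p`_i *: 'X^i.
Proof.
move=> sp; rewrite -poly_def; apply/polyP => i; rewrite coef_poly.
by case: ltnP => // ei; rewrite nth_default // (leq_trans sp).
Qed.

Lemma residue_expand A C (f : {poly R}) e : A \is monic -> (size f <= e)%N ->
  residue A (f * C) = \sum_(i < e) f`_i * moment A C i.
Proof.
move=> Am sf; rewrite {1}(poly_expand sf) mulr_suml residue_sum //.
by apply: eq_bigr => i _; rewrite -scalerAl residueZ.
Qed.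

(** Each further vanishing moment is exactly the next possible leading coefficient of [p], because
    ['X^s * p] is still reduced modulo [A]. *)
Lemma size_of_moments d A p s : A \is monic -> size A = d.+1 ->
  (size p <= d)%N -> (forall i, (i < s)%N -> moment A p i = 0) ->
  (size p <= d - s)%N.
Proof.
move=> Am sA sp; elim: s => [|s IH] h0; first by rewrite subn0.
have {}IH : (size p <= d - s)%N by apply: IH => i si; apply: h0; plia.
have [ds|sd] := leqP d s; first by rewrite (leq_trans IH); plia.
apply/leq_sizeP => i; have [->|ne] := eqVneq i (d - s.+1)%N; last first.
  by move=> ge; apply: (leq_sizeP _ _ IH); plia.
move=> _; have := h0 s (leqnn _); rewrite /moment (residue_small sA).
  rewrite coefXnM (_ : (d.-1 < s)%N = false); last by lia.
  by rewrite (_ : d.-1 - s = d - s.+1)%N //; lia.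
by rewrite (leq_trans (size_polyMleq _ _)) // size_polyXn; plia.
Qed.

(** * One Euclidean step on [(A, C)] *)

Section EuclideanStep.
Variables (s m : nat) (A C A' C' Q Q0 F F0 : {poly R}).
Hypotheses (A'm : A' \is monic) (sA' : size A' = m.+1) (sC' : (size C' <= m)%N).
Hypotheses (Qm : Q \is monic) (sQ : size Q = s.+1) (sQ0 : (size Q0 <= s)%N).
Hypotheses (defA : A = Q * A' - Q0 * C') (defC : C = F * A' - F0 * C').
Hypothesis bezout : Q0 * F - Q * F0 = 1.

Lemma euclid_size : (size (Q0 * C')%R < size (Q * A')%R)%N.
Proof.
rewrite (size_Mmonic (monic_neq0 Qm) A'm) sQ sA'.
by rewrite (leq_ltn_trans (size_polyMleq _ _)) //; plia.
Qed.

Lemma euclid_monic : A \is monic.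
Proof.
rewrite monicE defA lead_coefDl ?size_polyN ?euclid_size //.
by rewrite lead_coef_Mmonic ?(eqP Qm).
Qed.

Lemma euclid_sizeA : size A = (s + m).+1.
Proof.
rewrite defA size_polyDl ?size_polyN ?euclid_size //.
by rewrite size_Mmonic ?monic_neq0 // sQ sA'; plia.
Qed.

(** The matrix sending [(A', C')] to [(A, C)] has determinant 1 by [bezout]; inverting it recovers
    [C'] here and [A'] in the next lemma. Thus [F / Q] is a convergent of [C / A]. *)
Lemma euclid_remainder : Q * C = F * A + C'.
Proof.
by rewrite -[C' in RHS]mul1r -bezout defA defC; ring.
Qed.

Lemma euclid_remainder0 : Q0 * C = F0 * A + A'.
Proof.
by rewrite -[A' in RHS]mul1r -bezout defA defC; ring.
Qed.

Let quo k := rdivp ('X^k * C') A'.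
Let rem k := rmodp ('X^k * C') A'.
(** Modulo [A], ['X^k * Q * C] is ['X^k * C'], whose degree may be too large; subtracting
    [quo k * Q0] turns this into [rem k] and keeps the leading term. *)
Let g k := 'X^k * Q - quo k * Q0.

Let quorem k : 'X^k * C' = quo k * A' + rem k.
Proof. exact: rdivp_eq. Qed.

Let size_rem k : (size (rem k) <= m)%N.
Proof. by rewrite -ltnS -sA' ltn_rmodp monic_neq0. Qed.

Let size_quo k : (size (quo k) <= k)%N.
Proof.
have [->|q0] := eqVneq (quo k) 0; first by rewrite size_poly0.
have : size (quo k * A') = (size (quo k) + m)%N.
  by rewrite size_Mmonic // sA' addnS.
have -> : quo k * A' = 'X^k * C' - rem k by rewrite quorem addrK.
have := size_polyD ('X^k * C') (- rem k); rewrite size_polyN.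
have := size_polyMleq 'X^k C'; rewrite size_polyXn.
by have := size_rem k; plia.
Qed.

Let size_g_lt k : (size (quo k * Q0)%R < size ('X^k * Q)%R)%N.
Proof.
rewrite (size_Mmonic (monic_neq0 (monicXn _ k)) Qm) size_polyXn sQ.
rewrite (leq_ltn_trans (size_polyMleq _ _)) //; have := size_quo k; plia.
Qed.

Let size_g k : size (g k) = (s + k).+1.
Proof.
rewrite size_polyDl ?size_polyN ?size_g_lt //.
by rewrite size_Mmonic ?monic_neq0 ?monicXn // size_polyXn sQ; plia.
Qed.

Let g_monic k : g k \is monic.
Proof.
rewrite monicE lead_coefDl ?size_polyN ?size_g_lt //.
by rewrite lead_coef_Mmonic ?lead_coefXn.
Qed.

Let gC k : g k * C = ('X^k * F - quo k * F0) * A + rem k.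
Proof.
have -> : g k * C = 'X^k * (Q * C) - quo k * (Q0 * C) by rewrite /g; ring.
rewrite euclid_remainder euclid_remainder0.
have -> : rem k = 'X^k * C' - quo k * A' by rewrite quorem; ring.
ring.
Qed.

Let gA' k : g k * A' = 'X^k * A + Q0 * rem k.
Proof.
have -> : rem k = 'X^k * C' - quo k * A' by rewrite quorem; ring.
by rewrite /g defA; ring.
Qed.

Let orthogonal i k : (i < s)%N -> residue A ('X^i * g k * C) = 0.
Proof.
move=> si; rewrite -mulrA gC mulrDr mulrA residue_addl_mul ?euclid_monic //.
rewrite (residue_small0 euclid_sizeA) // (leq_trans (size_polyMleq _ _)) //.
by rewrite size_polyXn; have := size_rem k; plia.
Qed.

(** Modulo [A] only [g k * rem l] remains. Multiplying by [A'] and using [gA'] exchanges [A] for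
    [A'], up to [Q0 * rem k * rem l], whose degree is too small to have a residue modulo
    [A * A']. *)
Let gram k l : residue A (g k * g l * C) = moment A' C' (k + l).
Proof.
have Am := euclid_monic.
rewrite -mulrA gC mulrDr mulrA residue_addl_mul //.
rewrite -(residue_cancel _ Am A'm).
have -> : g k * rem l * A' = ('X^k * rem l) * A + Q0 * rem k * rem l.
  by rewrite mulrAC gA'; ring.
rewrite residueD ?rpredM // [X in _ + X](@residue_small0 (s + m + m)) ?addr0.
- by rewrite [A * A']mulrC residue_cancel // residue_rmod // mulrA -exprD.
- by rewrite size_Mmonic ?monic_neq0 // euclid_sizeA sA'; plia.
- have := size_polyMleq (Q0 * rem k) (rem l); have := size_polyMleq Q0 (rem k).
  by have := size_rem k; have := size_rem l; plia.
Qed.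

(* The polynomials [X^i] for [i < s], followed by [g 0, ..., g (t - 1)], form a
   basis of the polynomials of degree less than [s + t] in which the bilinear
   form [(u, v) |-> residue A (u * v * C)] is block diagonal. *)
Lemma hankel_euclid t :
  \det (hankel (s + t) (moment A C)) =
  \det (hankel s (moment A C)) * \det (hankel t (moment A' C')).
Proof.
have Am := euclid_monic.
pose b (k : 'I_(s + t)) :=
  match fintype.split k with inl i => 'X^i | inr i => g i end.
have sb k : size (b k) = k.+1.
  rewrite /b; case: (splitP k) => [i ->|i ->]; first by rewrite size_polyXn.
  by rewrite size_g.
have bm k : b k \is monic by rewrite /b; case: fintype.split => i; rewrite ?monicXn.
pose P : 'M[R]_(s + t) := \matrix_(i, k) (b k)`_i.
have detP : \det P = 1.
  rewrite -det_tr det_trig; last first.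
    by apply/is_trig_mxP => i k ik; rewrite !mxE nth_default // sb.
  rewrite big1 // => i _; rewrite !mxE.
  by have /eqP := bm i; rewrite lead_coefE sb.
have gramP k l : (P^T *m hankel (s + t) (moment A C) *m P) k l
    = residue A (b k * b l * C).
  rewrite -mulrA (@residue_expand _ _ _ (s + t)) ?sb //.
  transitivity (\sum_(i < s + t)
      (b k)`_i * \sum_(i0 < s + t) (b l)`_i0 * moment A C (i + i0)).
    rewrite mxE; under eq_bigr => i0 _ do rewrite mxE mulr_suml.
    rewrite exchange_big /=; apply: eq_bigr => i _; rewrite mulr_sumr.
    by apply: eq_bigr => i0 _; rewrite !mxE mulrAC -mulrA.
  apply: eq_bigr => i _; congr (_ * _).
  rewrite [RHS]/moment mulrCA (@residue_expand _ _ _ (s + t)) ?sb //.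
  by apply: eq_bigr => i0 _; rewrite /moment mulrA -exprD (addnC i0).
have : \det (P^T *m hankel (s + t) (moment A C) *m P) =
   \det (block_mx (hankel s (moment A C)) 0 0 (hankel t (moment A' C'))).
  congr (\det _); apply/matrixP => k l; rewrite gramP /b.
  case: (splitP k) => k' kE; case: (splitP l) => l' lE.
  - have -> : k = lshift t k' by apply/val_inj.
    have -> : l = lshift t l' by apply/val_inj.
    by rewrite block_mxEul mxE -exprD.
  - have -> : k = lshift t k' by apply/val_inj.
    have -> : l = rshift s l' by apply/val_inj.
    by rewrite block_mxEur mxE orthogonal.
  - have -> : l = lshift t l' by apply/val_inj.
    have -> : k = rshift s k' by apply/val_inj.
    by rewrite block_mxEdl mxE [g _ * _]mulrC orthogonal.
  - have -> : k = rshift s k' by apply/val_inj.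
    have -> : l = rshift s l' by apply/val_inj.
    by rewrite block_mxEdr mxE gram.
by rewrite det_ublock !det_mulmx det_tr detP mul1r mulr1.
Qed.

(** The form is nondegenerate in degree less than [s]: the hypothesis makes [f * C] of degree less
    than [m] modulo [A], hence [f * F = Q * z], and [bezout] makes the monic [Q] of degree [s]
    divide [f]. *)
Lemma hankel_euclid_inj (f : {poly R}) : (size f <= s)%N ->
  (forall i, (i < s)%N -> residue A ('X^i * f * C) = 0) -> f = 0.
Proof.
move=> sf h0; have Am := euclid_monic; have sA := euclid_sizeA.
pose r := rmodp (f * C) A; pose z := rdivp (f * C) A.
have fC : f * C = z * A + r by exact: rdivp_eq.
have sr : (size r <= m)%N.
  have -> : m = (s + m - s)%N by rewrite addKn.
  apply: (@size_of_moments _ A) => //.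
    by rewrite -ltnS -sA ltn_rmodp monic_neq0.
  by move=> i si; rewrite /moment residue_rmod // mulrA h0.
(* The right side has degree less than [s + m], the degree of the monic [A], so the cofactor of [A]
   vanishes. *)
have E : (f * F - Q * z) * A = Q * r - f * C'.
  have -> : f * C' = f * (Q * C) - f * F * A by rewrite euclid_remainder; ring.
  by rewrite mulrCA fC; ring.
have : f * F - Q * z = 0.
  apply/eqP/negP => /negP n0.
  have : size ((f * F - Q * z) * A) = (size (f * F - Q * z)%R + (s + m))%N.
    by rewrite size_Mmonic // sA addnS.
  rewrite E; have := size_polyD (Q * r) (- (f * C')); rewrite size_polyN.
  have := size_polyMleq Q r; have := size_polyMleq f C'; rewrite sQ.
  by move: n0; rewrite -size_poly_gt0; plia.
move/subr0_eq => fF; have fQ : f = Q * (Q0 * z - f * F0).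
  rewrite -[f in LHS]mulr1 -bezout.
  by rewrite mulrBr mulrCA fF; ring.
apply/eqP/negP => /negP n0.
have : Q * (Q0 * z - f * F0) != 0 by rewrite -fQ.
move=> n1; have : size (Q * (Q0 * z - f * F0)) = (size (Q0 * z - f * F0)%R + s)%N.
  rewrite mulrC size_Mmonic // ?sQ ?addnS //.
  by apply: contraNneq n1 => ->; rewrite mulr0.
rewrite -fQ => sfE.
suff : (0 < size (Q0 * z - f * F0)%R)%N by plia.
by rewrite size_poly_gt0; apply: contraNneq n1 => ->; rewrite mulr0.
Qed.

(** Two convergents with denominators of degree [s] are proportional for degree reasons, and
    [bezout] then makes [Q] divide [Q1]. This lets the backward step recover [(Q, F)] from
    [(A, C)]. *)
Lemma euclid_unique Q1 F1 C1 : Q1 \is monic -> size Q1 = s.+1 ->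
  (size C1 <= m)%N -> Q1 * C = F1 * A + C1 -> Q1 = Q /\ F1 = F.
Proof.
move=> Q1m sQ1 sC1 rem1; have Am := euclid_monic; have sA := euclid_sizeA.
have E : (F * Q1 - F1 * Q) * A = Q * C1 - Q1 * C'.
  have -> : C1 = Q1 * C - F1 * A by rewrite rem1; ring.
  by have -> : C' = Q * C - F * A by [rewrite euclid_remainder; ring]; ring.
have FQ : F * Q1 - F1 * Q = 0.
  apply/eqP/negP => /negP n0.
  have : size ((F * Q1 - F1 * Q) * A) = (size (F * Q1 - F1 * Q)%R + (s + m))%N.
    by rewrite size_Mmonic // sA addnS.
  rewrite E; have := size_polyD (Q * C1) (- (Q1 * C')); rewrite size_polyN.
  have := size_polyMleq Q C1; have := size_polyMleq Q1 C'; rewrite sQ sQ1.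
  by move: n0; rewrite -size_poly_gt0; plia.
have Q1E : Q1 = (Q0 * F1 - Q1 * F0) * Q.
  have -> : (Q0 * F1 - Q1 * F0) * Q = Q1 * (Q0 * F - Q * F0) - Q0 * (F * Q1 - F1 * Q).
    ring.
  by rewrite bezout FQ; ring.
have n0 : Q0 * F1 - Q1 * F0 != 0.
  by apply: contraNneq (monic_neq0 Q1m) => z0; rewrite Q1E z0 mul0r.
have [c cE] : exists c, Q0 * F1 - Q1 * F0 = c%:P.
  exists (Q0 * F1 - Q1 * F0)`_0; apply: size1_polyC.
  by have := sQ1; rewrite {1}Q1E size_Mmonic // sQ addnS /=; plia.
have c1 : c = 1.
  have /eqP := Q1m; rewrite {1}Q1E lead_coef_Mmonic // cE lead_coefC => ->.
  by [].
have QQ : Q1 = Q by rewrite Q1E cE c1 mul1r.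
split=> //; apply/eqP; rewrite -subr_eq0; apply/negP => /negP F1F.
have : size ((F1 - F) * Q) != 0%N.
  by rewrite size_Mmonic // sQ; move: F1F; rewrite -size_poly_gt0; plia.
by rewrite mulrBl -{2}QQ -opprB FQ oppr0 size_poly0.
Qed.

End EuclideanStep.
End Residue.

(** * From subresultants to Hankel determinants *)

Section Sylvester.
Variable R : comNzRingType.
Implicit Types A B C : {poly R}.

(** The matrix [subresultant_mx] over rings that may have zero divisors, such as [W / pi^N]. *)
Definition sylvester_mx (d j : nat) A B : 'M[R]_((d - j) + (d - j)) :=
  let block (p : {poly R}) : 'M[R]_((d - j) + (d - j), d - j) :=
    \matrix_(r, c) ('X^((d - j).-1 - c) * p)`_((d + d - j).-1 - r) in
  row_mx (block A) (block B).

Lemma hankel_rev_det e (h g : nat -> R) :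
  (forall i, (i < (e + e).-1)%N -> h i = g ((e + e).-2 - i)%N) ->
  \det (hankel e h) = \det (hankel e g).
Proof.
move=> hg; pose s : {perm 'I_e} := perm (@rev_ord_inj e).
have -> : hankel e h = row_perm s (col_perm s (hankel e g)).
  apply/matrixP => i k; rewrite !mxE !permE /= hg.
    by congr (g _); have := ltn_ord i; have := ltn_ord k; lia.
  by have := ltn_ord i; have := ltn_ord k; lia.
rewrite row_permE col_permE !det_mulmx !det_perm odd_permV.
by rewrite mulrCA -signr_addb addbb mulr1.
Qed.

(* Multiplying the Sylvester matrix on the left by the unitriangular matrix that
   expands a polynomial divided by [A] in powers of [X^-1] makes it block
   triangular, with an identity block and a Hankel block. *)
Lemma det_sylvester d j A B : (j <= d)%N -> A \is monic -> size A = d.+1 ->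
  (size B <= d.+1)%N -> exists b : bool,
  \det (sylvester_mx d j A B) = (-1) ^+ b * \det (hankel (d - j) (moment A B)).
Proof.
move=> jd Am sA sB; rewrite /sylvester_mx.
have [e de] : exists e, e = (d - j)%N by exists (d - j)%N.
rewrite -de; have -> : (d + d - j = d + e)%N by lia.
(* With ['X^e * A] as divisor, the residue of ['X^r * p] is the coefficient of [X^(e-1-r)] in
   [p / A]: rows [r < e] read its polynomial part and the next [e] rows its first negative
   powers. *)
pose XA := 'X^e * A; have XAm : XA \is monic by rewrite rpredM ?monicXn.
have sXA : size XA = (d + e).+1.
  by rewrite size_Mmonic ?monic_neq0 ?monicXn // size_polyXn sA; lia.
pose L : 'M[R]_(e + e) :=
  \matrix_(r, l) residue XA ('X^((d + e).-1 - l) * 'X^r).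
have detL : \det L = 1.
  rewrite det_trig.
    rewrite big1 // => i _; rewrite mxE -exprD; have := ltn_ord i => ie.
    rewrite (_ : (_ - i + i = (d + e).-1)%N); last by lia.
    rewrite (residue_small sXA) ?size_polyXn ?coefXn ?eqxx //; lia.
  apply/is_trig_mxP => i k ik; rewrite mxE -exprD (residue_small0 sXA) //.
  by rewrite size_polyXn; have := ltn_ord i; have := ltn_ord k; lia.
have LE (p : {poly R}) (r : 'I_(e + e)) : (size p <= d + e)%N ->
    \sum_(l < e + e) L r l * p`_((d + e).-1 - l) = residue XA ('X^r * p).
  move=> sp; rewrite mulrC (residue_expand _ XAm sp).
  rewrite [RHS](reindex_inj rev_ord_inj) /=.
  rewrite [RHS](bigID (fun l : 'I__ => l < e + e)%N) /=.
  rewrite [X in _ = _ + X]big1 ?addr0 => [|l le]; last first.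
    rewrite /moment -exprD (residue_small0 sXA) ?mulr0 // size_polyXn.
    by have := ltn_ord l; have := ltn_ord r; lia.
  under eq_bigr => l _ do rewrite mxE.
  rewrite (@big_ord_widen _ _ _ (e + e) (d + e)
    (fun l => residue XA ('X^((d + e).-1 - l) * 'X^r) * p`_((d + e).-1 - l)));
    last by lia.
  apply: eq_bigr => l _; rewrite mulrC.
  by rewrite (_ : (d + e - l.+1)%N = ((d + e).-1 - l)%N) //; lia.
set S := row_mx _ _.
pose T : 'M[R]_e := \matrix_(i, c) moment A B (i + (e.-1 - c)).
have LS : L *m S = block_mx 1%:M (usubmx (L *m rsubmx S)) 0 T.
  rewrite -[S in LHS]hsubmxK mul_mx_row -[L *m lsubmx S]vsubmxK.
  rewrite -[L *m rsubmx S in LHS]vsubmxK -block_mxEh; congr block_mx.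
  - apply/matrixP => i c; rewrite /S row_mxKl !mxE.
    under eq_bigr => l _ do rewrite [X in _ * X]mxE.
    rewrite LE; last first.
      rewrite (leq_trans (size_polyMleq _ _)) // size_polyXn sA.
      by have := ltn_ord c; lia.
    rewrite mulrA -exprD residue_cancel ?monicXn // (_ : _ + _ = c.+1.-1 + (e.-1 - c) + i - c)%N.
      rewrite /residue -take_poly_rmodp coef_take_poly size_polyXn coefXn.
      rewrite (_ : (e.+1.-2 < e)%N); last by have := ltn_ord c; lia.
      congr (_%:R); congr nat_of_bool; rewrite -(inj_eq val_inj) /=.
      by apply/eqP/eqP; have := ltn_ord c; have := ltn_ord i; lia.
    by rewrite /=; lia.
  - apply/matrixP => i c; rewrite /S row_mxKl !mxE.
    under eq_bigr => l _ do rewrite [X in _ * X]mxE.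
    rewrite LE; last first.
      rewrite (leq_trans (size_polyMleq _ _)) // size_polyXn sA.
      by have := ltn_ord c; lia.
    rewrite mulrA -exprD residue_cancel ?monicXn //=.
    rewrite /residue -take_poly_rmodp coef_take_poly size_polyXn coefXn.
    by case: ifP => // _; rewrite (_ : _ == _ = false) //; apply/eqP;
      have := ltn_ord c; have := ltn_ord i; lia.
  - apply/matrixP => i c; rewrite /S row_mxKr !mxE.
    under eq_bigr => l _ do rewrite [X in _ * X]mxE.
    rewrite LE; last first.
      rewrite (leq_trans (size_polyMleq _ _)) // size_polyXn.
      by have := ltn_ord c; lia.
    have -> : XA = A * 'X^e by rewrite mulrC.
    have -> : 'X^(rshift e i) * ('X^(e.-1 - c) * B) =
        'X^(i + (e.-1 - c)) * B * 'X^e by rewrite /= !exprD; ring.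
    by rewrite residue_cancel ?monicXn.
(* The columns of [T] come in the reverse of the Hankel order; the parity of this reversal is the
   sign [b]. *)
pose s : {perm 'I_e} := perm (@rev_ord_inj e).
have TE : T = col_perm s (hankel e (moment A B)).
  apply/matrixP => i c; rewrite !mxE permE /=; congr (moment _ _ (_ + _)).
  by have := ltn_ord c; lia.
exists (odd_perm s).
have := congr1 determinant LS; rewrite det_mulmx detL mul1r => ->.
by rewrite det_ublock det1 mul1r TE col_permE det_mulmx det_perm odd_permV mulrC.
Qed.

End Sylvester.

Section FiniteRing.
Variable R : finComNzRingType.

(** An injective self-map of a finite set is onto, and preimages of the basis vectors are the
    columns of a right inverse of [M]. *)
Lemma finite_unit_det n (M : 'M[R]_n) :
  (forall v : 'cV[R]_n, M *m v = 0 -> v = 0) -> exists u, \det M * u = 1.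
Proof.
move=> Minj; have f_inj : injective (fun v : 'cV[R]_n => M *m v).
  by move=> v w /eqP; rewrite -subr_eq0 -mulmxBr => /eqP /Minj /subr0_eq.
have [g _ gK] := injF_bij f_inj.
pose K : 'M[R]_n := \matrix_(i, k) g (delta_mx k 0) i 0.
exists (\det K); rewrite -det_mulmx (_ : M *m K = 1%:M) ?det1 //.
apply/matrixP => i k; have := congr1 (fun v : 'cV[R]_n => v i 0) (gK (delta_mx k 0)).
by rewrite /= !mxE eqxx andbT => <-; apply: eq_bigr => l _; rewrite mxE.
Qed.

(** The leading block in [hankel_euclid] is a unit, so dropping it changes no divisibility of the
    determinant. *)
Lemma hankel_euclid_unit s m (A C A' C' Q Q0 F F0 : {poly R}) :
  A' \is monic -> size A' = m.+1 -> (size C' <= m)%N ->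
  Q \is monic -> size Q = s.+1 -> (size Q0 <= s)%N ->
  A = Q * A' - Q0 * C' -> C = F * A' - F0 * C' -> Q0 * F - Q * F0 = 1 ->
  exists u, \det (hankel s (moment A C)) * u = 1.
Proof.
move=> A'm sA' sC' Qm sQ sQ0 defA defC bez; apply: finite_unit_det => v Hv.
have Am : A \is monic by apply: (euclid_monic A'm sA' sC' Qm sQ sQ0 defA).
pose f := \poly_(i < s) (if insub i is Some k then v k 0 else 0).
have fE (k : 'I_s) : f`_k = v k 0.
  by rewrite coef_poly ltn_ord; case: insubP => [k' _ /val_inj->|]; rewrite ?ltn_ord.
have f0 : f = 0.
  apply: (hankel_euclid_inj A'm sA' sC' Qm sQ sQ0 defA defC bez).
    exact: size_poly.
  move=> i si; rewrite -mulrA mulrCA (@residue_expand _ _ _ _ s) ?size_poly //.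
  have := congr1 (fun v : 'cV[R]_s => v (Ordinal si) 0) Hv; rewrite !mxE => Hi; rewrite -[RHS]Hi.
  apply: eq_bigr => k _; rewrite !mxE mulrC /moment mulrA -exprD fE.
  by rewrite [(k + i)%N]addnC.
by apply/colP => k; rewrite -fE f0 coef0 mxE.
Qed.

End FiniteRing.

(** * Counting tuples *)

Section TupleSums.
Local Open Scope nat_scope.
Variables (T : finType) (x0 : T).

Lemma sum_tuple0 (F : seq T -> nat) : \sum_(t : 0.-tuple T) F t = F [::].
Proof.
rewrite (eq_bigr (fun=> F [::])) => [|t _]; last by rewrite tuple0.
by rewrite sum_nat_const card_tuple expn0 mul1n.
Qed.

Lemma sum_tupleS n (F : seq T -> nat) :
  \sum_(t : n.+1.-tuple T) F t = \sum_x \sum_(t : n.-tuple T) F (x :: t).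
Proof.
rewrite pair_bigA /= (reindex (fun u : T * n.-tuple T => [tuple of u.1 :: u.2])).
  by apply: eq_bigr => -[x t] _.
exists (fun t => (thead t, [tuple of behead t])) => [[x t] _|t _] /=.
  by congr pair; apply/val_inj.
by rewrite [t in RHS]tuple_eta.
Qed.

Lemma sum_tuple_take w v (F : seq T -> nat) :
  \sum_(t : (w + v).-tuple T) F (take w t) =
  #|T| ^ v * \sum_(t : w.-tuple T) F t.
Proof.
elim: w F => [|w IH] F.
  under eq_bigr => t _ do rewrite take0.
  by rewrite sum_tuple0 sum_nat_const card_tuple.
rewrite (sum_tupleS _ (fun t => F (take w.+1 t))) sum_tupleS big_distrr /=.
by apply: eq_bigr => x _; exact: (IH (fun t => F (x :: t))).
Qed.

Lemma sum_tuple_rev n (F : seq T -> nat) :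
  \sum_(t : n.-tuple T) F (rev t) = \sum_(t : n.-tuple T) F t.
Proof.
rewrite [RHS](reindex_inj (h := fun t : n.-tuple T => [tuple of rev t])) //.
by move=> s t /(congr1 val) /= /(can_inj revK) /val_inj.
Qed.

Lemma sum_tuple_prod n (F : nat -> T -> nat) :
  \sum_(t : n.-tuple T) \prod_(i < n) F i (nth x0 t i) =
  \prod_(i < n) \sum_x F i x.
Proof.
elim: n F => [|n IH] F.
  by rewrite (sum_tuple0 (fun t => \prod_(i < 0) F i (nth x0 t i))) !big_ord0.
rewrite (sum_tupleS _ (fun t => \prod_(i < n.+1) F i (nth x0 t i))).
rewrite big_ord_recl /= big_distrl /=; apply: eq_bigr => x _.
under eq_bigr => t _ do rewrite big_ord_recl /=.
by rewrite -big_distrr /= (IH (fun i => F i.+1)).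
Qed.

Lemma nat_of_forall n (P : 'I_n -> bool) :
  ([forall i, P i] : nat) = \prod_(i < n) (P i : nat).
Proof.
case: forallP => [h|h]; first by rewrite big1 // => i _; rewrite h.
have /forallPn[i /negbTE Pi] : ~~ [forall i, P i] by apply/forallP.
by rewrite (bigD1 i) //= Pi mul0n.
Qed.

Lemma sum_nat_of_bool (S : finType) (P : pred S) :
  \sum_(x : S) (P x : nat) = #|[pred x | P x]|.
Proof.
rewrite -sum1_card [RHS]big_mkcond /=; apply: eq_bigr => x _.
by rewrite inE; case: (P x).
Qed.

Lemma card_tuple_forall n (P : nat -> pred T) :
  #|[pred t : n.-tuple T | [forall i : 'I_n, P i (nth x0 t i)]]| =
  \prod_(i < n) #|[pred x | P i x]|.
Proof.
rewrite -sum_nat_of_bool; under eq_bigr => t _ do rewrite nat_of_forall.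
rewrite (sum_tuple_prod n (fun i x => P i x : nat)).
by apply: eq_bigr => i _; rewrite sum_nat_of_bool.
Qed.

Lemma prod_ordD m n (F : nat -> nat) :
  \prod_(i < m + n) F i = \prod_(i < m) F i * \prod_(i < n) F (m + i).
Proof. by rewrite big_split_ord. Qed.

Lemma prod_ord_const n (F : nat -> nat) c : (forall i, i < n -> F i = c) ->
  \prod_(i < n) F i = c ^ n.
Proof.
move=> h; rewrite (eq_bigr (fun=> c)) => [|i _]; last by rewrite h.
by rewrite big_const_ord iter_muln_1.
Qed.

Lemma card_predX (S1 S2 : finType) (D : pred S1) (G : pred S2) :
  #|[pred u : S1 * S2 | D u.1 && G u.2]| = #|[pred x | D x]| * #|[pred x | G x]|.
Proof.
rewrite -!sum_nat_of_bool big_distrl /= -(pair_bigA _ (fun x y => (D x && G y) : nat)) /=.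
apply: eq_bigr => x _; rewrite big_distrr /=; apply: eq_bigr => y _.
by rewrite mulnb.
Qed.

Lemma card_preim_inj (S : finType) (p : pred S) (g : S -> S) : injective g ->
  #|[pred x | p (g x)]| = #|p|.
Proof.
move=> gI; rewrite -(sum_nat_of_bool (fun x => p (g x))).
have <- : #|[pred x | p x]| = #|p| by apply: eq_card.
by rewrite -(sum_nat_of_bool p) [RHS](reindex_inj gI).
Qed.

(* An injection into a predicate of the same cardinality is a bijection. *)
Lemma card_transport (S1 S2 : finType) (D : pred S1) (T2 : pred S2) (f : S1 -> S2)
    (P1 : pred S1) (P2 : pred S2) :
  {in D &, injective f} -> (forall x, D x -> T2 (f x)) -> #|D| = #|T2| ->
  (forall x, D x -> P1 x = P2 (f x)) ->
  #|[pred x | D x & P1 x]| = #|[pred y | T2 y & P2 y]|.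
Proof.
move=> inj DT cDT P12.
have inj1 : {in [pred x | D x & P1 x] &, injective f}.
  by move=> x y /andP[Dx _] /andP[Dy _]; apply: inj.
rewrite -(card_in_image inj1); apply: eq_card => y; rewrite !inE.
have imT : [seq f x | x in D] =i T2.
  apply/subset_cardP; first by rewrite card_in_image.
  by apply/fintype.subsetP => z /fintype.imageP[x Dx ->]; apply: DT.
apply/fintype.imageP/andP => [[x /andP[Dx Px] ->]|[Ty Py]].
  by rewrite DT // -P12.
have : y \in [seq f x | x in D] by rewrite imT.
by case/fintype.imageP=> x Dx yE; exists x => //; apply/andP; rewrite P12 // -yE.
Qed.

End TupleSums.

(** * Counting over a finite chain ring *)

Section TuplePoly.
Variable R : comNzRingType.

Definition mpoly d (a : seq R) : {poly R} := 'X^d + Poly a.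

Definition ptuple d (p : {poly R}) : d.-tuple R := [tuple p`_i | i < d].

Lemma size_Poly_tuple d (a : d.-tuple R) : (size (Poly a) <= d)%N.
Proof. by rewrite (leq_trans (size_Poly _)) ?size_tuple. Qed.

Lemma size_mpoly d (a : d.-tuple R) : size (mpoly d a) = d.+1.
Proof. by rewrite size_polyDl size_polyXn // ltnS size_Poly_tuple. Qed.

Lemma mpoly_monic d (a : d.-tuple R) : mpoly d a \is monic.
Proof.
by rewrite monicE lead_coefDl ?lead_coefXn ?size_polyXn // ltnS size_Poly_tuple.
Qed.

Lemma nth_ptuple d (p : {poly R}) i : (i < d)%N -> (ptuple d p)`_i = p`_i.
Proof. by move=> id; rewrite -[i]/(val (Ordinal id)) -tnth_nth tnth_mktuple. Qed.

Lemma Poly_ptuple d (p : {poly R}) : (size p <= d)%N -> Poly (ptuple d p) = p.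
Proof.
move=> sp; apply/polyP => i; rewrite coef_Poly; have [id|di] := ltnP i d.
  by rewrite nth_ptuple.
by rewrite !nth_default ?size_tuple // (leq_trans sp).
Qed.

Lemma mpoly_ptuple d (p : {poly R}) : p \is monic -> size p = d.+1 -> mpoly d (ptuple d p) = p.
Proof.
move=> pm sp; apply/polyP => i; rewrite coefD coefXn coef_Poly.
have [id|di|->] := ltngtP i d; first by rewrite add0r nth_ptuple.
  by rewrite add0r !nth_default ?size_tuple ?sp // ltnW.
rewrite nth_default ?size_tuple // addr0; have /eqP := pm.
by rewrite lead_coefE sp.
Qed.

Lemma Poly_tuple_inj d : injective (fun a : d.-tuple R => Poly a).
Proof.
move=> a b ab; apply/val_inj/(@eq_from_nth _ 0) => [|i _]; first by rewrite !size_tuple.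
by have := congr1 (fun p : {poly R} => p`_i) ab; rewrite !coef_Poly.
Qed.

Lemma mpoly_inj d : injective (fun a : d.-tuple R => mpoly d a).
Proof. by move=> a b /addrI /Poly_tuple_inj. Qed.

End TuplePoly.

(** * The Euclidean step run backwards *)

Section Euclid.
Variable R : finComNzRingType.

(** In [mom], a pair stands for [(A, C)] with [A] monic of degree [d], its leading coefficient left
    out, and [C] of degree less than [d]. *)
Definition pairs d : finType := (d.-tuple R * d.-tuple R)%type.

Definition mom d (x : pairs d) : nat -> R := moment (mpoly d x.1) (Poly x.2).

Lemma momentZ (A C : {poly R}) a i : A \is monic ->
  moment A (a *: C) i = a * moment A C i.
Proof. by move=> Am; rewrite /moment -scalerAr residueZ. Qed.

Lemma momentB (A C1 C2 : {poly R}) i : A \is monic ->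
  moment A (C1 - C2) i = moment A C1 i - moment A C2 i.
Proof.
by move=> Am; rewrite /moment mulrBr residueD // -scaleN1r residueZ // mulN1r.
Qed.

Lemma moments_eq0 d (A C : {poly R}) : A \is monic -> size A = d.+1 ->
  (size C <= d)%N -> (forall i, (i < d)%N -> moment A C i = 0) -> C = 0.
Proof.
move=> Am sA sC h; apply/eqP; rewrite -size_poly_leq0 -(subnn d).
exact: (size_of_moments Am sA sC h).
Qed.

Definition momv d (x : pairs d) : d.-tuple R := [tuple mom x i | i < d].

Lemma nth_momv d (x : pairs d) i : (i < d)%N -> (momv x)`_i = mom x i.
Proof. by move=> id; rewrite -[i]/(val (Ordinal id)) -tnth_nth tnth_mktuple. Qed.

Lemma momv_inj d (a c1 c2 : d.-tuple R) :
  (forall i, (i < d)%N -> mom (a, c1) i = mom (a, c2) i) -> c1 = c2.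
Proof.
move=> h; apply/Poly_tuple_inj/eqP; rewrite -subr_eq0; apply/eqP.
have am := mpoly_monic a; apply: (moments_eq0 am (size_mpoly a)) => [|i id].
  by rewrite (leq_trans (size_polyD _ _)) // size_polyN geq_max !size_Poly_tuple.
by rewrite momentB // -/(mom (a, c1) i) h // subrr.
Qed.

(** For a fixed [A], the map from [C] to its first [d] moments is injective between sets of the same
    size: the first [d] moments of a uniform pair are uniform. *)
Lemma sum_momv d (F : seq R -> nat) :
  (\sum_(x : pairs d) F (momv x) = #|R| ^ d * \sum_(h : d.-tuple R) F h)%N.
Proof.
have inj : injective (fun x : pairs d => (x.1, momv x)).
  move=> [a1 c1] [a2 c2] [/= <- h]; congr pair; apply: (@momv_inj _ a1) => i id.
  by rewrite -!nth_momv //= h.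
transitivity (\sum_(y : pairs d) F y.2)%N.
  by rewrite [RHS](reindex_inj inj).
rewrite -(pair_bigA _ (fun (a : d.-tuple R) (c : d.-tuple R) => F c)) /=.
by rewrite sum_nat_const card_tuple.
Qed.

Definition has_bezout s (z : pairs s) : bool :=
  [exists w : pairs s, Poly w.1 * Poly z.2 - mpoly s z.1 * Poly w.2 == 1].

Definition bezout_pair s (z : pairs s) : pairs s :=
  odflt z [pick w : pairs s | Poly w.1 * Poly z.2 - mpoly s z.1 * Poly w.2 == 1].

Lemma bezout_pairP s (z : pairs s) : has_bezout z ->
  Poly (bezout_pair z).1 * Poly z.2 - mpoly s z.1 * Poly (bezout_pair z).2 = 1.
Proof.
rewrite /bezout_pair => /existsP[w wP]; case: pickP => [w' /eqP //|h].
by rewrite h in wP.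
Qed.

(* The euclidean step, run backwards: [u.1] holds the coefficients of the
   convergent [F / Q] and [u.2] those of the reduced pair [(A', C')]. *)
Definition euclid_back s m (u : pairs s * pairs m) : pairs (s + m) :=
  let w := bezout_pair u.1 in
  (ptuple _ (mpoly s u.1.1 * mpoly m u.2.1 - Poly w.1 * Poly u.2.2),
   ptuple _ (Poly u.1.2 * mpoly m u.2.1 - Poly w.2 * Poly u.2.2)).

Section Back.
Variables (s m : nat) (u : pairs s * pairs m).
Let A' := mpoly m u.2.1.
Let C' := Poly u.2.2.
Let Q := mpoly s u.1.1.
Let F := Poly u.1.2.
Let Q0 := Poly (bezout_pair u.1).1.
Let F0 := Poly (bezout_pair u.1).2.

Lemma euclid_backA : mpoly (s + m) (euclid_back u).1 = Q * A' - Q0 * C'.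
Proof.
apply: mpoly_ptuple.
  by apply: (@euclid_monic _ s m _ A' C' Q Q0) => //;
    rewrite ?mpoly_monic ?size_mpoly ?size_Poly_tuple.
by apply: (@euclid_sizeA _ s m _ A' C' Q Q0) => //;
  rewrite ?mpoly_monic ?size_mpoly ?size_Poly_tuple.
Qed.

Lemma euclid_backC : Poly (euclid_back u).2 = F * A' - F0 * C'.
Proof.
apply: Poly_ptuple; rewrite (leq_trans (size_polyD _ _)) // size_polyN.
have := size_polyMleq F A'; have := size_polyMleq F0 C'.
rewrite size_mpoly; have := size_Poly_tuple u.1.2; have := size_Poly_tuple u.2.2.
have := size_Poly_tuple (bezout_pair u.1).2; rewrite -/F -/F0 -/C'.
by plia.
Qed.

End Back.

(** [euclid_unique] recovers the convergent, hence also [bezout_pair], which depends on nothing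
    else; the two remainder identities then give back [C'] and [A']. *)
Lemma euclid_back_inj s m (u v : pairs s * pairs m) :
  has_bezout u.1 -> has_bezout v.1 -> euclid_back u = euclid_back v -> u = v.
Proof.
move=> /bezout_pairP bu /bezout_pairP bv uv.
have Au := euclid_backA u; have Av := euclid_backA v.
have Cu := euclid_backC u; have Cv := euclid_backC v.
rewrite -uv in Av Cv.
have remv := euclid_remainder Av Cv bv.
have [QQ FF] := euclid_unique (mpoly_monic _) (size_mpoly _) (size_Poly_tuple _)
  (mpoly_monic _) (size_mpoly _) (size_Poly_tuple _) Au Cu bu
  (mpoly_monic _) (size_mpoly _) (size_Poly_tuple _) remv.
have uv1 : u.1 = v.1.
  by move: QQ FF => /mpoly_inj QQ /Poly_tuple_inj FF;
    rewrite [u.1]surjective_pairing [v.1]surjective_pairing QQ FF.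
have remu := euclid_remainder Au Cu bu.
have rem0u := euclid_remainder0 Au Cu bu; have rem0v := euclid_remainder0 Av Cv bv.
have uv2 : u.2 = v.2.
  rewrite [u.2]surjective_pairing [v.2]surjective_pairing; congr pair.
    by apply: mpoly_inj; move: rem0u; rewrite uv1 rem0v => /addrI.
  by apply: Poly_tuple_inj; move: remu; rewrite uv1 remv => /addrI.
by rewrite [u]surjective_pairing [v]surjective_pairing uv1 uv2.
Qed.

(** Since [nu] is nilpotent modulo [Q], a truncated geometric series inverts [F] modulo [Q]. *)
Lemma has_bezout_nil s (z : pairs s) (f g : R) (nu w : {poly R}) K :
  (0 < s)%N -> f * g = 1 -> Poly z.2 = f%:P * (1 - nu) ->
  nu ^+ K = w * mpoly s z.1 -> has_bezout z.
Proof.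
move=> s0 fg Fnu nuK; set Q := mpoly s z.1 in nuK *; set F := Poly z.2 in Fnu *.
have Qm : Q \is monic by apply: mpoly_monic.
have sQ : size Q = s.+1 by apply: size_mpoly.
pose G := g%:P * \sum_(i < K) nu ^+ i.
have FG : F * G = 1 - w * Q.
  rewrite -nuK -[1 - nu ^+ K]opprB subrX1 -mulNr opprB Fnu /G.
  rewrite -[RHS]mul1r -[1 : {poly R}]/(1%:P) -fg polyCM; ring.
(* Reducing [G] modulo [Q] bounds the size of [Q0]; that of [F0] is then bounded through
   [F0 * Q = Q0 * F - 1]. *)
pose Q0 := rmodp G Q; pose F0 := - (w + rdivp G Q * F).
have bez : Q0 * F - Q * F0 = 1.
  have -> : Q0 = G - rdivp G Q * Q by apply/eqP; rewrite eq_sym subr_eq addrC -rdivp_eq.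
  have -> : 1 = F * G + w * Q by rewrite FG subrK.
  by rewrite /F0; ring.
have sQ0 : (size Q0 <= s)%N by rewrite -ltnS -sQ ltn_rmodp monic_neq0.
have sF : (size F <= s)%N := size_Poly_tuple _.
have sF0 : (size F0 <= s)%N.
  have [->|n0] := eqVneq F0 0; first by rewrite size_poly0.
  have : size (F0 * Q) = (size F0 + s)%N by rewrite size_Mmonic // sQ addnS.
  have -> : F0 * Q = Q0 * F - 1 by rewrite -bez; ring.
  have := size_polyD (Q0 * F) (- 1); rewrite size_polyN size_poly1.
  have := size_polyMleq Q0 F; clearbody Q0 F0 F; plia.
apply/existsP; exists (ptuple s Q0, ptuple s F0).
by rewrite /= !Poly_ptuple // -/F -/Q bez.
Qed.

End Euclid.

(** * Finite chain rings *)

Section ChainRing.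
Variables (R : finComNzRingType) (pi : R) (N q : nat).

Definition dv n (x : R) : bool := [exists y, x == pi ^+ n * y].

(* A finite chain ring of length [N] with residue field of cardinality [q]. *)
Record chain_ring : Prop := ChainRing {
  chain_length : (0 < N)%N;
  chain_residue : (1 < q)%N;
  chain_card : #|R| = (q ^ N)%N;
  chain_card_max : #|[pred x | dv 1 x]| = (q ^ N.-1)%N;
  chain_nil : pi ^+ N = 0;
  chain_cancel : forall n k x, (k <= n <= N)%N -> dv n (pi ^+ k * x) -> dv (n - k) x;
  chain_unit : forall x, ~~ dv 1 x -> exists y, x * y = 1 }.

Hypothesis RC : chain_ring.

Let N_gt0 := chain_length RC.
Let q_gt1 := chain_residue RC.

Lemma dvP n x : reflect (exists y, x = pi ^+ n * y) (dv n x).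
Proof. by apply: (iffP existsP) => -[y yE]; exists y; apply/eqP. Qed.

Lemma dv0 x : dv 0 x.
Proof. by apply/dvP; exists x; rewrite mul1r. Qed.

Lemma dv_0 n : dv n 0.
Proof. by apply/dvP; exists 0; rewrite mulr0. Qed.

Lemma dvM n x y : dv n x -> dv n (y * x).
Proof. by case/dvP=> z ->; apply/dvP; exists (y * z); rewrite mulrCA. Qed.

Lemma dvB n x y : dv n x -> dv n y -> dv n (x - y).
Proof.
by case/dvP=> x' -> /dvP[y' ->]; apply/dvP; exists (x' - y'); rewrite mulrBr.
Qed.

Lemma dvD n x y : dv n x -> dv n y -> dv n (x + y).
Proof.
by case/dvP=> x' -> /dvP[y' ->]; apply/dvP; exists (x' + y'); rewrite mulrDr.
Qed.

Lemma dv_sum n (I : Type) (r : seq I) (P : pred I) (F : I -> R) :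
  (forall i, P i -> dv n (F i)) -> dv n (\sum_(i <- r | P i) F i).
Proof. by move=> h; elim/big_ind: _ => //; [apply: dv_0|apply: dvD]. Qed.

Lemma dv_pi n k x : (n <= N)%N -> dv n (pi ^+ k * x) = dv (n - k) x.
Proof.
move=> nN; have [kn|nk] := leqP k n; last first.
  rewrite (_ : n - k = 0)%N ?dv0; last by lia.
  by apply/dvP; exists (pi ^+ (k - n) * x); rewrite mulrA -exprD subnKC // ltnW.
apply/idP/idP => [|/dvP[y ->]]; first by apply: (chain_cancel RC); rewrite kn.
by apply/dvP; exists y; rewrite mulrA -exprD subnKC.
Qed.

Lemma dv_unit n u v x : u * v = 1 -> dv n (u * x) = dv n x.
Proof.
move=> uv; apply/idP/idP => [|]; last exact: dvM.
by move/(dvM v); rewrite mulrA [v * u]mulrC uv mul1r.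
Qed.

(** Multiplication by [pi ^+ N.-1] stands in for reduction modulo [pi]: in the two counting steps
    below, congruences modulo [pi] are equalities after this scaling. *)
Lemma dv_socle x : (pi ^+ N.-1 * x == 0) = dv 1 x.
Proof.
apply/eqP/idP => [e|/dvP[y ->]].
  have : dv N (pi ^+ N.-1 * x) by rewrite e dv_0.
  by rewrite dv_pi // (_ : N - N.-1 = 1)%N //; lia.
by rewrite mulrA -exprD addn1 prednK // (chain_nil RC) mul0r.
Qed.

Lemma dv_one : ~~ dv 1 1.
Proof.
rewrite -dv_socle mulr1; apply/eqP => e.
have : dv N (pi ^+ N.-1 * 1) by rewrite mulr1 e dv_0.
rewrite dv_pi // (_ : N - N.-1 = 1)%N; last by lia.
case/dvP=> y e1; have : (1 : R) ^+ N = 0.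
  by rewrite e1 expr1 exprMn (chain_nil RC) mul0r.
by rewrite expr1n => /eqP; rewrite oner_eq0.
Qed.

Lemma dv_one_gt0 n : (n <= N)%N -> dv n 1 = (n == 0%N).
Proof.
case: n => [|n] nN; first by rewrite dv0.
apply/negbTE/negP => /dvP[y e]; have := dv_one; rewrite [X in dv 1 X]e exprS -mulrA.
by rewrite -[X in X * _]expr1 dv_pi ?dv0.
Qed.

Definition cardM : nat := #|[pred x | dv 1 x]|.

Lemma card_chain : #|R| = (q * cardM)%N.
Proof.
by rewrite /cardM (chain_card_max RC) (chain_card RC) -expnS prednK.
Qed.

Lemma card_units : #|[pred x | ~~ dv 1 x]| = (#|R| - cardM)%N.
Proof.
rewrite /cardM -(cardC [pred x | dv 1 x]) addKn.
by apply: eq_card => x; rewrite !inE.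
Qed.

(** The nonempty fibers of multiplication by [pi] are translates of its kernel; taking [F] constant
    equal to 1 shows that the kernel has [q] elements. *)
Lemma sum_mul_pi (F : R -> nat) :
  (\sum_x F (pi * x)%R = q * \sum_(z | dv 1 z) F z)%N.
Proof.
pose ker := #|[pred x | pi * x == 0]|.
have fiber z : dv 1 z -> #|[pred x | pi * x == z]| = ker.
  case/dvP=> y ->; rewrite expr1 -(card_imset _ (@addIr _ (- y))) /=.
  rewrite -[RHS](card_imset _ (@addIr _ 0)); apply: eq_card => x.
  apply/imsetP/imsetP => -[w]; rewrite inE => /eqP we ->.
    by exists (w - y); rewrite ?addr0 // inE mulrBr we subrr.
  by exists (w + y); rewrite ?addr0 ?addrK // inE mulrDr we add0r.
have E G : (\sum_x G (pi * x)%R = ker * \sum_(z | dv 1 z) G z)%N.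
  rewrite (partition_big (fun x => pi * x) (dv 1)) /=; last first.
    by move=> x _; apply/dvP; exists x.
  rewrite big_distrr /=; apply: eq_bigr => z dz; rewrite -(fiber z dz).
  rewrite (eq_bigr (fun=> G z)) => [|x /eqP-> //].
  by rewrite sum_nat_const.
have := E (fun=> 1%N); rewrite !sum1_card card_chain -/cardM => /eqP.
rewrite eqn_pmul2r => [/eqP->|]; first exact: E.
by rewrite /cardM (chain_card_max RC) expn_gt0 ltnW.
Qed.

Lemma sum_tuple_mul_pi w (F : seq R -> nat) :
  (\sum_(t : w.-tuple R) F (map ( *%R pi) t) =
   q ^ w * \sum_(t : w.-tuple R | all (dv 1) t) F t)%N.
Proof.
rewrite [in RHS]big_mkcond /=.
elim: w F => [|w IH] F.
  rewrite (sum_tuple0 (fun t => F (map ( *%R pi) t))) mul1n.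
  by rewrite (sum_tuple0 (fun t => if all (dv 1) t then F t else 0%N)).
rewrite (sum_tupleS _ (fun t => F (map ( *%R pi) t))) /=.
rewrite (sum_tupleS _ (fun t => if all (dv 1) t then F t else 0%N)) /=.
under eq_bigr => x _ do rewrite (IH (fun t => F (pi * x :: t))).
rewrite -big_distrr expnSr -mulnA /=.
rewrite (sum_mul_pi (fun z => \sum_(t : w.-tuple R)
  if all (dv 1) t then F (z :: t) else 0%N)); congr (_ * (_ * _))%N.
rewrite big_mkcond /=; apply: eq_bigr => x _; case: (dv 1 x) => //=.
by rewrite big1.
Qed.

(** The common frame of both steps: [D] constrains the convergent, [G] the smaller pair and [T] the
    result. The equality of cardinals replaces a proof that [euclid_back] reaches all of [T]. *)
Lemma euclid_count s m t n (D : pred (pairs R s)) (G : pred (pairs R m))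
    (T : pred (pairs R (s + m))) :
  (forall z, D z -> has_bezout z) ->
  (forall z y, D z -> G y -> T (euclid_back (z, y))) ->
  (#|[pred z | D z]| * #|[pred y | G y]| = #|[pred x | T x]|)%N ->
  #|[pred x | T x & dv n (\det (hankel (s + t) (mom x)))]| =
  (#|[pred z | D z]| * #|[pred y | G y & dv n (\det (hankel t (mom y)))]|)%N.
Proof.
move=> Dbez DGT cDG; rewrite -card_predX.
pose X := [pred u : pairs R s * pairs R m | D u.1 && G u.2].
pose P1 (u : pairs R s * pairs R m) := dv n (\det (hankel t (mom u.2))).
rewrite -(@card_transport _ _ X T (@euclid_back R s m) P1) /X.
- by apply: eq_card => u; rewrite !inE andbA.
- by move=> u v /andP[Du _] /andP[Dv _]; apply: euclid_back_inj; apply: Dbez.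
- by move=> [z y] /andP[Dz Gy]; apply: DGT.
- by rewrite card_predX cDG; apply: eq_card.
move=> u /andP[Du Gu]; have bu := bezout_pairP (Dbez _ Du).
rewrite /P1 /mom.
rewrite (@hankel_euclid _ s m _ _ _ _ _ _ _ _ (mpoly_monic _) (size_mpoly _)
  (size_Poly_tuple _) (mpoly_monic _) (size_mpoly _) (size_Poly_tuple _)
  (euclid_backA u) (euclid_backC u) bu).
have [v uv] := hankel_euclid_unit (mpoly_monic _) (size_mpoly _)
  (size_Poly_tuple _) (mpoly_monic _) (size_mpoly _) (size_Poly_tuple _)
  (euclid_backA u) (euclid_backC u) bu.
by rewrite (dv_unit _ _ uv).
Qed.

Lemma poly_dv1 (p : {poly R}) : (forall i, dv 1 p`_i) -> exists p1, p = pi *: p1.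
Proof.
move=> h; exists (\poly_(i < size p) odflt 0 [pick y | p`_i == pi * y]).
apply/polyP => i; rewrite coefZ coef_poly; case: ltnP => si; last first.
  by rewrite mulr0 nth_default.
by case: pickP => [y /eqP //|e]; have /dvP[y] := h i; rewrite expr1 => /eqP; rewrite e.
Qed.

End ChainRing.

(** * First unit inside the leading block *)

Section Steps.
Variables (R : finComNzRingType) (pi : R) (N q : nat).
Hypothesis RC : chain_ring pi N q.
Local Notation dv := (dv pi).
Local Notation cM := (cardM pi).
Local Notation socle := (pi ^+ N.-1).

(** Moments are indexed from 0, so index [s] here is index [s + 1] in the overview, and the case
    [s <= e] there is [s < e] here. *)
Definition first_unit s (h : nat -> R) : bool :=
  [forall i : 'I_s, dv 1 (h i)] && ~~ dv 1 (h s).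

Lemma first_unitP s h : reflect
  ((forall i, (i < s)%N -> dv 1 (h i)) /\ ~~ dv 1 (h s)) (first_unit s h).
Proof.
apply: (iffP andP) => -[h1 h2]; split=> //.
  by move=> i si; have /forallP/(_ (Ordinal si)) := h1.
by apply/forallP => i; apply: h1.
Qed.

Lemma eq_first_unit s (h g : nat -> R) : (forall i, (i <= s)%N -> h i = g i) ->
  first_unit s h = first_unit s g.
Proof.
move=> hg; rewrite /first_unit hg //; congr andb.
by apply: eq_forallb => i; rewrite hg // ltnW.
Qed.

Lemma card_momv d (P : pred (pairs R d)) (F : pred (seq R)) :
  (forall x, P x = F (momv x)) ->
  #|[pred x | P x]| = (#|R| ^ d * #|[pred h : d.-tuple R | F h]|)%N.
Proof.
move=> PF.
rewrite -(sum_nat_of_bool P) -(sum_nat_of_bool (fun h : d.-tuple R => F h)).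
rewrite -[RHS](sum_momv d (fun h => nat_of_bool (F h))).
by apply: eq_bigr => x _; rewrite PF.
Qed.

Lemma card_tuple_mask n a b (P : nat -> pred R) c1 c2 c3 : (a + 1 + b = n)%N ->
  (forall i, (i < a)%N -> #|[pred x | P i x]| = c1) -> #|[pred x | P a x]| = c2 ->
  (forall i, (a < i < n)%N -> #|[pred x | P i x]| = c3) ->
  #|[pred t : n.-tuple R | [forall i : 'I_n, P i (nth 0 t i)]]| =
  (c1 ^ a * c2 * c3 ^ b)%N.
Proof.
move=> <- h1 h2 h3; rewrite card_tuple_forall.
rewrite (prod_ordD _ _ (fun i => #|[pred x | P i x]|)).
rewrite (prod_ordD _ _ (fun i => #|[pred x | P i x]|)).
rewrite (@prod_ord_const a (fun i => #|[pred x | P i x]|) c1) // big_ord1 addn0 h2.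
rewrite (@prod_ord_const b (fun i => #|[pred x | P (a + 1 + i)%N x]|) c3) //.
by move=> i ib; apply: h3; lia.
Qed.

Lemma card_first_unit n s : (s < n)%N ->
  #|[pred t : n.-tuple R | first_unit s (nth 0 t)]| =
  (cM ^ s * (#|R| - cM) * #|R| ^ (n - s.+1))%N.
Proof.
move=> sn; pose P i : pred R := if (i < s)%N then dv 1 else
  if i == s then predC (dv 1) else predT.
rewrite -(@card_tuple_mask n s (n - s.+1) P) //; last first.
- by move=> i /andP[si _]; rewrite /P ltnNge ltnW //= gtn_eqF.
- by rewrite /P ltnn eqxx -card_units.
- by move=> i si; rewrite /P si.
- by lia.
apply: eq_card => t; rewrite !inE; apply/first_unitP/forallP => [[h1 h2] i|h].
  rewrite /P; case: ltnP => si; first exact: h1.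
  by case: eqVneq => [->|].
split=> [i si|].
  by have := h (Ordinal (ltn_trans si sn)); rewrite /P /= si.
by have := h (Ordinal sn); rewrite /P /= ltnn eqxx.
Qed.

Lemma socle_eq0 (p : {poly R}) : (forall i, dv 1 p`_i) -> socle *: p = 0.
Proof.
by move=> h; apply/polyP => i; rewrite coefZ coef0; apply/eqP; rewrite (dv_socle RC).
Qed.

(** Here [nu] is a multiple of [pi], hence nilpotent whatever [Q] is. *)
Lemma has_bezout_small s (z : pairs R s.+1) : ~~ dv 1 (Poly z.2)`_0 ->
  (forall i, (0 < i)%N -> dv 1 (Poly z.2)`_i) -> has_bezout z.
Proof.
move=> fu fdv; have [g fg] := chain_unit RC fu.
have [F1 FE] : exists F1, Poly z.2 - ((Poly z.2)`_0)%:P = pi *: F1.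
  apply: poly_dv1 => i; rewrite coefB coefC; case: eqVneq => [->|i0].
    by rewrite subrr dv_0.
  by rewrite subr0 fdv // lt0n.
apply: (@has_bezout_nil R s.+1 z _ g (- (g%:P * (pi *: F1))) 0 N _ fg) => //.
  by rewrite opprK mulrDr mulr1 mulrA -polyCM fg mul1r -FE addrC subrK.
by rewrite mul0r -scalerAr -scalerN exprZn (chain_nil RC) scale0r.
Qed.

(** Modulo [pi], [F] is a unit constant [f] and [C] becomes [f] times [A'], so the expansion of
    [C / A] starts with [f X^-(s+1)]: the first unit has index [s]. No condition bears on [Q] or on
    the smaller pair. *)
Lemma count_small_step s m t n :
  #|[pred x : pairs R (s.+1 + m) |
      first_unit s (mom x) & dv n (\det (hankel (s.+1 + t) (mom x)))]| =
  (#|R| ^ s.+1 * ((#|R| - cM) * cM ^ s) *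
   #|[pred y : pairs R m | dv n (\det (hankel t (mom y)))]|)%N.
Proof.
pose P i : pred R := fun x => if i == 0%N then ~~ dv 1 x else dv 1 x.
pose D (z : pairs R s.+1) : bool := xpredT z.1 &&
  [forall i : 'I_s.+1, P i (nth 0 z.2 i)].
have DP z : D z -> ~~ dv 1 (Poly z.2)`_0 /\ forall i, (0 < i)%N -> dv 1 (Poly z.2)`_i.
  move=> /forallP h; split.
    by have := h ord0; rewrite /P /= coef_Poly.
  move=> i i0; rewrite coef_Poly; have [is1|is1] := ltnP i s.+1.
    by have := h (Ordinal is1); rewrite /P /= gtn_eqF.
  by rewrite nth_default ?size_tuple // dv_0.
have cD : #|[pred z | D z]| = (#|R| ^ s.+1 * ((#|R| - cM) * cM ^ s))%N.
  rewrite -(card_tuple s.+1 R).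
  etransitivity; first exact: (card_predX xpredT
    (fun c : s.+1.-tuple R => [forall i : 'I_s.+1, P i (nth 0 c i)])).
  congr (_ * _)%N; rewrite (@card_tuple_mask s.+1 0 s P 1 (#|R| - cM) cM) ?mul1n //.
    by rewrite /P -card_units.
  by move=> i /andP[i0 _]; rewrite /P gtn_eqF.
rewrite -cD (@euclid_count _ _ _ _ _ _ D xpredT (fun x => first_unit s (mom x))) //.
- by move=> z /DP[fu fdv]; apply: has_bezout_small.
- move=> z y Dz _; have [fu fdv] := DP _ Dz.
  have bez := bezout_pairP (has_bezout_small fu fdv).
  have Cu := euclid_backC (z, y); have Am := mpoly_monic (euclid_back (z, y)).1.
  have sA := size_mpoly (euclid_back (z, y)).1.
  set x := euclid_back (z, y) in Cu Am sA *; rewrite /= in Cu.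
  set F := Poly z.2 in fu fdv bez Cu *; set f := F`_0 in fu *.
  set F0 := Poly (bezout_pair z).2 in bez Cu.
  set Q0 := Poly (bezout_pair z).1 in bez.
  set Q := mpoly s.+1 z.1 in bez.
  have Qm : Q \is monic by apply: mpoly_monic.
  have sQ : size Q = s.+2 by apply: size_mpoly.
  have sQ0 : (size Q0 <= s.+1)%N by apply: size_Poly_tuple.
  have kF : socle *: F = (socle * f)%:P.
    rewrite -[F](subrK f%:P) scalerDr socle_eq0 ?add0r ?mul_polyC -?polyCM //.
      by rewrite polyCM mul_polyC.
    move=> i; rewrite coefB coefC; case: eqVneq => [->|i0].
      by rewrite subrr dv_0.
    by rewrite subr0 fdv // lt0n.
  (* Modulo [pi], [Q * F0] equals [f] times [Q0] minus 1, of degree less than that of the monic [Q];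
     so [F0] vanishes there. *)
  have kF0 : socle *: F0 = 0.
    have E : (socle *: F0) * Q = Q0 * (socle * f)%:P - socle%:P.
      have -> : socle%:P = socle *: (Q0 * F - Q * F0).
        by rewrite bez -mul_polyC mulr1.
      by rewrite -kF -!mul_polyC; ring.
    apply/eqP/negP => /negP n0.
    have : size ((socle *: F0) * Q) = (size (socle *: F0) + s.+1)%N.
      by rewrite size_Mmonic // sQ addnS.
    rewrite E; have := size_polyD (Q0 * (socle * f)%:P) (- socle%:P).
    have := size_polyMleq Q0 (socle * f)%:P; rewrite size_polyN.
    have := size_polyC_leq1 (socle * f); have := size_polyC_leq1 socle.
    by move: n0; rewrite -size_poly_gt0; clearbody Q0 F0; plia.
  have kC : socle *: Poly x.2 = (socle * f) *: mpoly m y.1.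
    rewrite Cu scalerBr !scalerAl kF kF0 mul0r subr0 mul_polyC.
    by [].
  have momE i : socle * mom x i = socle * f * residue (mpoly (s.+1 + m) x.1)
      ('X^i * mpoly m y.1).
    by rewrite /mom -momentZ // kC momentZ.
  apply/first_unitP; split=> [i si|].
    rewrite -(dv_socle RC) momE (residue_small0 sA) ?mulr0 //.
    by rewrite size_Mmonic ?mpoly_monic ?monic_neq0 ?monicXn // size_polyXn size_mpoly; lia.
  rewrite -(dv_socle RC) momE (residue_small sA); last first.
    by rewrite size_Mmonic ?mpoly_monic ?monic_neq0 ?monicXn // size_polyXn size_mpoly; lia.
  rewrite coefXnM (_ : (_ < s)%N = false); last by lia.
  have -> : ((s.+1 + m).-1 - s = (size (mpoly m y.1)).-1)%N.
    by rewrite size_mpoly; lia.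
  by rewrite -lead_coefE (eqP (mpoly_monic _)) mulr1 (dv_socle RC).
rewrite cD (_ : #|[pred y : pairs R m | true]| = #|R| ^ m * #|R| ^ m)%N; last first.
  by rewrite -!card_tuple -card_prod; apply: eq_card.
rewrite (card_momv (F := fun h => first_unit s (nth 0 h))); last first.
  by move=> x; apply: eq_first_unit => i si; rewrite nth_momv //; lia.
rewrite card_first_unit; last by lia.
rewrite (_ : s.+1 + m - s.+1 = m)%N; last by lia.
by rewrite expnD; ring.
Qed.

End Steps.

(** * First unit beyond the leading block *)

Section LargeSteps.
Variables (R : finComNzRingType) (pi : R) (N q : nat).
Hypothesis RC : chain_ring pi N q.
Local Notation dv := (dv pi).
Local Notation cM := (cardM pi).
Local Notation socle := (pi ^+ N.-1).
Local Notation first_unit := (first_unit pi).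

Lemma card_tuple_take w v (F : pred (seq R)) :
  #|[pred t : (w + v).-tuple R | F (take w t)]| =
  (#|R| ^ v * #|[pred t : w.-tuple R | F t]|)%N.
Proof.
rewrite -(sum_nat_of_bool (fun t : w.-tuple R => F t)).
rewrite -(sum_tuple_take w v (fun t => nat_of_bool (F t))).
by rewrite -(sum_nat_of_bool (fun t : (w + v).-tuple R => F (take w t))).
Qed.

Lemma card_tuple_rev n (F : pred (seq R)) :
  #|[pred t : n.-tuple R | F (rev t)]| = #|[pred t : n.-tuple R | F t]|.
Proof.
rewrite -(sum_nat_of_bool (fun t : n.-tuple R => F t)).
rewrite -(sum_tuple_rev n (fun t => nat_of_bool (F t))).
by rewrite -(sum_nat_of_bool (fun t : n.-tuple R => F (rev t))).
Qed.

Lemma card_tuple_mul_pi w (F : pred (seq R)) :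
  (q ^ w * #|[pred t : w.-tuple R | all (dv 1) t & F t]| =
   #|[pred t : w.-tuple R | F (map ( *%R pi) t)]|)%N.
Proof.
rewrite -(sum_nat_of_bool (fun t : w.-tuple R => F (map ( *%R pi) t))).
rewrite (sum_tuple_mul_pi RC w (fun t => nat_of_bool (F t))); congr (_ * _)%N.
rewrite -(sum_nat_of_bool (fun t : w.-tuple R => all (dv 1) t && F t)).
rewrite [RHS]big_mkcond; apply: eq_bigr => t _.
by case: (all _ _).
Qed.

Lemma card_all_dv w : #|[pred t : w.-tuple R | all (dv 1) t]| = (cM ^ w)%N.
Proof.
rewrite -(@prod_ord_const w (fun=> #|[pred x | dv 1 x]|) cM) //.
rewrite -(card_tuple_forall 0 w (fun=> dv 1)); apply: eq_card => t; rewrite !inE.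
apply/(all_nthP 0)/forallP => [h i|h i]; first by apply: h; rewrite size_tuple.
by rewrite size_tuple => iw; apply: (h (Ordinal iw)).
Qed.

Lemma det_hankelZ e a (h : nat -> R) :
  \det (hankel e (fun i => a * h i)) = a ^+ e * \det (hankel e h).
Proof.
by rewrite -detZ; congr (\det _); apply/matrixP => i k; rewrite !mxE.
Qed.

Lemma det_hankel_map e (t : seq R) : \det (hankel e (nth 0 (map ( *%R pi) t))) =
  pi ^+ e * \det (hankel e (nth 0%R t)).
Proof.
rewrite -det_hankelZ; congr (\det _); apply: eq_hankel => i _.
have [it|ti] := ltnP i (size t); first by rewrite (nth_map 0).
by rewrite !nth_default ?size_map // mulr0.
Qed.

(** Modulo [pi], [Q] is a power of [X]; hence [X] is nilpotent modulo [Q], and [F] is a unit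
    constant plus a multiple of [X]. *)
Lemma has_bezout_large r (z : pairs R r.+1) : (forall i, dv 1 (Poly z.1)`_i) ->
  ~~ dv 1 (Poly z.2)`_0 -> has_bezout z.
Proof.
move=> Qdv fu; have [g fg] := chain_unit RC fu; have [Q1 QE] := poly_dv1 Qdv.
pose F1 := drop_poly 1 (Poly z.2).
have FE : Poly z.2 = ((Poly z.2)`_0)%:P + F1 * 'X.
  rewrite -[LHS](poly_take_drop 1) expr1; congr (_ + _).
  by apply/polyP => i; rewrite coef_take_poly coefC; case: i.
pose nu1 := - (g%:P * F1).
(* [Q] is ['X^(r.+1) + pi *: Q1], which divides the difference of the [N]-th powers of ['X^(r.+1)]
   and [- (pi *: Q1)]; the second power is 0. *)
have XN : exists S : {poly R}, ('X^(r.+1)) ^+ N = S * mpoly r.+1 z.1.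
  exists (\sum_(i < N) ('X^(r.+1)) ^+ (N.-1 - i) * (- (pi *: Q1)) ^+ i).
  have := subrXX 'X^(r.+1) (- (pi *: Q1)) N.
  rewrite -scalerN [X in _ - X]exprZn (chain_nil RC) scale0r subr0 => ->.
  by rewrite scalerN opprK -QE mulrC.
have [S SE] := XN.
apply: (@has_bezout_nil R r.+1 z _ g (nu1 * 'X) (nu1 ^+ (r.+1 * N) * S) (r.+1 * N) _ fg) => //.
  by rewrite [LHS]FE /nu1 !mulNr opprK mulrDr mulr1 !mulrA -polyCM fg mul1r.
by rewrite exprMn -mulrA -SE -exprM.
Qed.

(** Here [e = r.+1 + k] and [h] has length [2e - 1]. Read backwards, [h] has a unit at [r] followed
    only by multiples of [pi]: modulo [pi] it expands a fraction [F / X^(r+1)] with [F(0)] a unit.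
    To apply the Euclidean step, the reversed vector is realized as the moments of auxiliary pairs
    of degree [2e - 1], whence the first factor on the left. *)
Lemma count_large_step r k n (w := (k + k).-1) : (0 < k)%N ->
  (#|R| ^ (r.+1 + (w + r.+1)) *
   #|[pred h : (r.+1 + (w + r.+1)).-tuple R | first_unit (w + r.+1) (nth 0%R h)
       & dv n (\det (hankel (r.+1 + k) (nth 0%R h)))]| =
   cM ^ r.+1 * ((#|R| - cM) * #|R| ^ r) * (#|R| ^ (w + r.+1) * (#|R| ^ r.+1 *
   #|[pred t : w.-tuple R | all (dv 1) t & dv n (\det (hankel k (nth 0%R t)))]|)))%N.
Proof.
move=> k0; set m := (w + r.+1)%N.
pose PF i : pred R := fun x => (i == 0%N) ==> ~~ dv 1 x.
pose D (z : pairs R r.+1) : bool := all (dv 1) z.1 &&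
  [forall i : 'I_r.+1, PF i (nth 0 z.2 i)].
have DP z : D z -> (forall i, dv 1 (Poly z.1)`_i) /\ ~~ dv 1 (Poly z.2)`_0.
  move=> /andP[/(all_nthP 0) h1 /forallP h2]; split=> [i|]; last first.
    by have := h2 ord0; rewrite /PF coef_Poly.
  rewrite coef_Poly; have [ir|ir] := ltnP i (size z.1); first exact: h1.
  by rewrite nth_default // dv_0.
have cD : #|[pred z | D z]| = (cM ^ r.+1 * ((#|R| - cM) * #|R| ^ r))%N.
  rewrite -card_all_dv; etransitivity; first exact: (card_predX
    (fun c : r.+1.-tuple R => all (dv 1) c)
    (fun c : r.+1.-tuple R => [forall i : 'I_r.+1, PF i (nth 0 c i)])).
  congr (_ * _)%N.
  rewrite (@card_tuple_mask _ r.+1 0 r PF 1 (#|R| - cM) #|R|) ?mul1n //.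
    by rewrite -card_units; apply: eq_card.
  by move=> i /andP[i0 _]; rewrite /PF gtn_eqF.
(* The [w = 2k - 1] moments seen by the Hankel matrix of size [k] must be multiples of [pi]; the
   other [r.+1] are free. *)
pose G (y : pairs R m) : bool := all (dv 1) (take w (momv y)).
have cGE (H : pred (seq R)) :
    #|[pred y : pairs R m | G y & H (take w (momv y))]| =
    (#|R| ^ m * (#|R| ^ r.+1 * #|[pred t : w.-tuple R | all (dv 1) t & H t]|))%N.
  rewrite (card_momv (F := fun h => all (dv 1) (take w h) && H (take w h))) //.
  by rewrite (card_tuple_take w r.+1 (fun h => all (dv 1) h && H h)).
pose P i : pred R := fun x => if (i < r)%N then true else
  if i == r then ~~ dv 1 x else dv 1 x.
pose FT (g : seq R) := [forall i : 'I_(r.+1 + m), P i (nth 0 g i)].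
pose T (x : pairs R (r.+1 + m)) : bool := FT (momv x).
have cT : #|[pred x | T x]| =
    (#|R| ^ (r.+1 + m) * (#|R| ^ r * (#|R| - cM) * cM ^ m))%N.
  rewrite (card_momv (F := FT)) //; congr (_ * _)%N.
  rewrite (@card_tuple_mask _ _ r m P #|R| (#|R| - cM) cM) //.
  - by rewrite addn1.
  - by move=> i ir; rewrite /P ir.
  - by rewrite /P ltnn eqxx -card_units; apply: eq_card.
  - by move=> i /andP[ri _]; rewrite /P ltnNge (ltnW ri) /= gtn_eqF.
have step := @euclid_count R pi r.+1 m k n D G T.
have <- : #|[pred x | T x & dv n (\det (hankel (r.+1 + k) (mom x)))]| =
   (#|R| ^ (r.+1 + m) *
   #|[pred h : (r.+1 + m).-tuple R | first_unit m (nth 0%R h)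
       & dv n (\det (hankel (r.+1 + k) (nth 0%R h)))]|)%N.
  pose FH g := FT g && dv n (\det (hankel (r.+1 + k) (nth 0%R g))).
  rewrite (card_momv (F := FH)).
    rewrite -(card_tuple_rev _ FH); congr (_ * _)%N.
    apply: eq_card => h; rewrite !inE /FH; congr andb; last first.
      congr dv; apply: hankel_rev_det => i ik; rewrite nth_rev size_tuple.
        by congr (nth _ _ _); rewrite /m /w in ik *; lia.
      by rewrite /m /w in ik *; lia.
    apply/forallP/first_unitP => [h1|[h1 h2] i]; last first.
      rewrite nth_rev ?size_tuple // /P; case: ltnP => // ri.
      case: eqVneq => [->|ir]; last by apply: h1; have := ltn_ord i; lia.
      by rewrite (_ : (_ - r.+1)%N = m) // addKn.
    split=> [i im|].
      have im' : (r.+1 + m - i.+1 < r.+1 + m)%N by lia.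
      have := h1 (Ordinal im'); rewrite /= nth_rev ?size_tuple // /P.
      rewrite ifF; last by lia.
      rewrite ifF; last by apply/eqP; lia.
      by rewrite (_ : _ - _ = i)%N //; lia.
    have rm : (r < r.+1 + m)%N by lia.
    have := h1 (Ordinal rm); rewrite /= nth_rev ?size_tuple // /P ltnn eqxx.
    by rewrite addKn.
  move=> x; rewrite /FH (@eq_hankel _ _ (mom x) (nth 0%R (momv x))) // => i ik.
  by rewrite nth_momv //; rewrite /m /w; lia.
rewrite {}step; last first.
- have <- : #|[pred y | G y & true]| = #|[pred y | G y]|.
    by apply: eq_card => y; rewrite !inE andbT.
  rewrite cT cD (cGE xpredT).
  have -> : #|[pred t : w.-tuple R | all (dv 1) t & true]| = (cM ^ w)%N.
    by rewrite -card_all_dv; apply: eq_card => y; rewrite !inE andbT.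
  by rewrite /m !(expnD, expnS); ring.
- move=> z y /DP[Qdv fu] Gy; have bez := bezout_pairP (has_bezout_large Qdv fu).
  have Au := euclid_backA (z, y).
  have Cu := euclid_backC (z, y); have Am := mpoly_monic (euclid_back (z, y)).1.
  have sA := size_mpoly (euclid_back (z, y)).1.
  have := euclid_remainder Au Cu bez.
  set x := euclid_back (z, y) in Am sA *; set A := mpoly (r.+1 + m) x.1 in Am sA *.
  set C := Poly x.2; rewrite /=; set F := Poly z.2; set C' := Poly y.2.
  set Q := mpoly r.+1 z.1 => QCE.
  have kQ : socle *: Q = socle *: 'X^(r.+1).
    by rewrite /Q /mpoly scalerDr (socle_eq0 RC Qdv) addr0.
  have E : 'X^(r.+1) * (socle *: C) = (socle *: F) * A + socle *: C'.
    by rewrite -scalerAr scalerAl -kQ -scalerAl QCE scalerDr scalerAl.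
  (* Modulo [pi] the first [w] moments of [C'] vanish, which leaves degree at most [r]. *)
  have sC' : (size (socle *: C') <= r.+1)%N.
    have -> : r.+1 = (m - w)%N by rewrite /m addKn.
    apply: (size_of_moments (mpoly_monic y.1) (size_mpoly _)).
      by rewrite (leq_trans (size_scale_leq _ _)) // size_Poly_tuple.
    move=> i iw; rewrite momentZ ?mpoly_monic //; apply/eqP.
    rewrite (dv_socle RC) -/(mom y i) -nth_momv; last by rewrite /m; lia.
    have := all_nthP 0 Gy i; rewrite nth_take //; apply.
    by rewrite size_takel ?size_tuple // /m leq_addr.
  have momE i : socle * mom x i = residue A ('X^i * (socle *: C)).
    by rewrite /mom -momentZ.
  apply/forallP => i; rewrite nth_momv // /P; have := ltn_ord i => im.
  case: ltnP => // ri; case: eqVneq => [->|nri]; last first.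
    rewrite -(dv_socle RC) momE.
    have -> : 'X^i = 'X^(i - r.+1) * 'X^(r.+1) :> {poly R}.
      by rewrite -exprD subnK //; lia.
    rewrite -mulrA E mulrDr mulrA residue_addl_mul // (residue_small0 sA) //.
    by rewrite (leq_trans (size_polyMleq _ _)) // size_polyXn; clearbody C'; plia.
  (* At index [r] one factor [X] is missing to apply [E]. The part of [F] divisible by [X] goes into
     a multiple of [A]; by [XZ] the rest, [Z], has the scaled constant coefficient of [F] as top
     coefficient. *)
  pose F1 := drop_poly 1 F; pose Z := 'X^r * (socle *: C) - (socle *: F1) * A.
  have FE : F = (F`_0)%:P + F1 * 'X.
    rewrite -[LHS](poly_take_drop 1) expr1; congr (_ + _).
    by apply/polyP => l; rewrite coef_take_poly coefC; case: l.
  have XZ : 'X * Z = (socle * F`_0)%:P * A + socle *: C'.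
    rewrite mulrBr mulrA -exprS E {1}FE scalerDr mulrDl -[in RHS]mul_polyC.
    by rewrite -!mul_polyC polyCM; ring.
  have ZE l : Z`_l = ('X * Z)`_l.+1 by rewrite coefXM.
  have sZ : (size Z <= r.+1 + m)%N.
    apply/leq_sizeP => l lr; rewrite ZE XZ coefD mul_polyC coefZ.
    rewrite [A`__]nth_default ?sA // mulr0 add0r nth_default //.
    by rewrite (leq_trans sC'); lia.
  rewrite -(dv_socle RC) momE.
  have -> : 'X^r * (socle *: C) = (socle *: F1) * A + Z by rewrite /Z addrC subrK.
  rewrite residue_addl_mul //.
  rewrite (residue_small sA sZ) ZE XZ coefD mul_polyC coefZ.
  rewrite [(socle *: C')`__]nth_default; last by rewrite (leq_trans sC'); lia.
  rewrite addr0 (_ : (r.+1 + m).-1.+1 = (size A).-1)%N; last by rewrite sA; lia.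
  by rewrite -lead_coefE (eqP Am) mulr1 (dv_socle RC).
- by move=> z /DP[Qdv fu]; apply: has_bezout_large.
rewrite cD; congr (_ * _)%N.
rewrite -[RHS](cGE (fun t => dv n (\det (hankel k (nth 0%R t))))).
apply: eq_card => y; rewrite !inE.
rewrite (@eq_hankel _ k (mom y) (nth 0%R (take w (momv y)))) // => i ik.
by rewrite nth_take ?nth_momv //; rewrite /m /w; lia.
Qed.

End LargeSteps.

(** * Dependent moments and the case without unit *)

Section Recursion.
Variables (R : finComNzRingType) (pi : R) (N q : nat).
Hypothesis RC : chain_ring pi N q.
Local Notation dv := (dv pi).
Local Notation cM := (cardM pi).
Local Notation first_unit := (first_unit pi).

Lemma dvMM n x y : dv n x -> dv 1 y -> dv n.+1 (x * y).
Proof.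
case/dvP=> x' -> /dvP[y' ->]; apply/dvP; exists (x' * y').
by rewrite expr1 mulrACA -exprSr.
Qed.

(** [A] is the characteristic polynomial of the sequence of moments, since multiples of [A] have no
    residue. *)
Lemma mom_rec d (x : pairs R d) i :
  mom x (d + i) = - \sum_(l < d) x.1`_l * mom x (l + i).
Proof.
have Am := mpoly_monic x.1; apply/eqP; rewrite -addr_eq0; apply/eqP.
have := residue_mull ('X^i * Poly x.2) Am; rewrite [_ * mpoly _ _]mulrC.
rewrite (residue_expand _ Am (_ : (_ <= d.+1)%N)) ?size_mpoly // => h.
rewrite -[RHS]h big_ord_recr /= [RHS]addrC; congr (_ + _); last first.
  apply: eq_bigr => l _; rewrite coefD coefXn ltn_eqF // add0r coef_Poly.
  by rewrite /mom /moment mulrA -exprD.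
rewrite coefD coefXn eqxx coef_Poly nth_default ?size_tuple // addr0 mul1r.
by rewrite /mom /moment mulrA -exprD.
Qed.

Section Dependent.
Variables (d n1 s : nat).
Hypotheses (sd : (s < d)%N) (n1s : (n1 <= s.+1)%N).

(** The indices of the [n1] coefficients of [A], ending at [s], to be recovered from the [n1]
    moments beyond the first [d]. *)
Let win l := (s < l + n1)%N && (l <= s)%N.

(** At [l = s - k], the coefficient [h (l + i)] is the unit [h s] for [i = k] and a multiple of [pi]
    for [i < k], so the system is triangular modulo [pi]. The proof gains one power of [pi] at a
    time, until [pi ^+ N = 0]. *)
Lemma rec_inj (a b : d.-tuple R) (h : nat -> R) : first_unit s h ->
  (forall i, (i < n1)%N -> \sum_(l < d) (a`_l - b`_l) * h (l + i)%N = 0) ->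
  (forall l, (l < d)%N -> ~~ win l -> a`_l = b`_l) -> a = b.
Proof.
move=> /first_unitP[hs hu] hsum hwin.
suff dvN t l : (l < d)%N -> dv t (a`_l - b`_l).
  apply/val_inj/(@eq_from_nth _ 0); rewrite ?size_tuple // => l ld.
  apply/eqP; rewrite -subr_eq0; have /dvP[y ->] := dvN N l ld.
  by rewrite (chain_nil RC) mul0r.
elim: t l => [|t IH] l ld; first exact: dv0.
have [/andP[w1 w2]|nw] := boolP (win l); last by rewrite hwin // subrr dv_0.
have [i iE] : exists i, i = (s - l)%N by exists (s - l)%N.
have {w1 w2} [i1 lE] : (i < n1)%N /\ l = (s - i)%N by lia.
rewrite {}lE {iE} in ld *; elim/ltn_ind: i i1 ld => i IHi i1 ld.
have iS : (i <= s)%N by lia.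
have [u hv] := chain_unit RC hu.
suff : dv t.+1 (h s * (a`_(s - i) - b`_(s - i))) by rewrite (dv_unit _ _ _ hv).
(* Row [i] is solved for its pivot, of index [s - i]. A term before the pivot gains a factor [pi]
   from [h]; one after it is zero or covered by the induction on [i]. *)
have := hsum i i1; rewrite (bigD1 (Ordinal ld)) //= subnK // mulrC => /eqP.
rewrite addr_eq0 => /eqP->; rewrite -sub0r; apply: dvB; first exact: dv_0.
apply: dv_sum => l' nl'; have [ls|ls] := ltnP (l' + i) s.
  by apply: dvMM; [apply: IH|apply: hs].
have ne : l' != (s - i)%N :> nat by [].
have [wl'|nw] := boolP (win l'); last by rewrite hwin // subrr mul0r dv_0.
move: wl' => /andP[w1 w2]; have -> : (l' : nat) = (s - (s - l'))%N by lia.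
by rewrite mulrC; apply: dvM; apply: IHi; lia.
Qed.

(** Given the first unit, exchanging the [n1] window coefficients of [A] for the [n1] dependent
    moments is injective between sets of the same size; hence all [d + n1] moments are uniform. *)
Lemma card_first_unit_dependent (F : pred (seq R)) :
  #|[pred x : pairs R d | first_unit s (mom x) & F (mkseq (mom x) (d + n1))]| =
  (#|[pred h : (d + n1).-tuple R | first_unit s (nth 0%R h) & F h]| *
   #|R| ^ (d - n1))%N.
Proof.
pose f (x : pairs R d) : (d + n1).-tuple R * d.-tuple R :=
  ([tuple mom x i | i < d + n1], [tuple if win l then 0 else x.1`_l | l < d]).
pose D (x : pairs R d) : bool := first_unit s (mom x).
pose PW l : pred R := fun x => win l ==> (x == 0).
pose W (b : d.-tuple R) : bool := [forall l : 'I_d, PW l (nth 0%R b l)].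
have cW : #|[pred b | W b]| = (#|R| ^ (d - n1))%N.
  rewrite card_tuple_forall.
  have dE : (d = s.+1 - n1 + n1 + (d - s.+1))%N by lia.
  have c1 l : win l -> #|[pred x | PW l x]| = 1%N.
    by move=> wl; rewrite -(card1 (0 : R)); apply: eq_card => x; rewrite !inE /PW wl.
  have c0 l : ~~ win l -> #|[pred x | PW l x]| = #|R|.
    by move=> wl; apply: eq_card => x; rewrite !inE /PW (negbTE wl).
  rewrite [in LHS]dE !(prod_ordD _ _ (fun l => #|[pred x | PW l x]|)).
  rewrite (@prod_ord_const (s.+1 - n1) (fun l => #|[pred x | PW l x]|) #|R|).
    rewrite (@prod_ord_const n1 (fun l => #|[pred x | PW (s.+1 - n1 + l)%N x]|) 1%N).
      rewrite (@prod_ord_const _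
        (fun l => #|[pred x | PW (s.+1 - n1 + n1 + l)%N x]|) #|R|).
        by rewrite exp1n muln1 -expnD; congr expn; lia.
      by move=> l ll; apply: c0; rewrite /win; lia.
    by move=> l ll; apply: c1; rewrite /win; lia.
  by move=> l ll; apply: c0; rewrite /win; lia.
pose T (y : (d + n1).-tuple R * d.-tuple R) : bool :=
  first_unit s (nth 0%R y.1) && W y.2.
have nthf x i : (i < d + n1)%N -> nth 0%R (f x).1 i = mom x i.
  by move=> id; rewrite -[i]/(val (Ordinal id)) -tnth_nth tnth_mktuple.
have nthf2 x i : (i < d)%N -> nth 0%R (f x).2 i = if win i then 0%R else x.1`_i.
  by move=> id; rewrite -[i]/(val (Ordinal id)) -tnth_nth tnth_mktuple.
pose FD (x : pairs R d) := F (mkseq (mom x) (d + n1)).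
pose FT (y : (d + n1).-tuple R * d.-tuple R) := F y.1.
have DT : forall x, D x -> T (f x).
  move=> x Dx; apply/andP; split.
    rewrite (@eq_first_unit _ _ _ _ (mom x)) // => i si; rewrite nthf //; lia.
  by apply/forallP => l; rewrite /PW nthf2 //; case: (win l); rewrite /= ?eqxx.
have cDT : #|D| = #|T|.
  have -> : #|D| = #|[pred x | D x]| by apply: eq_card.
  rewrite (card_momv (F := fun h => first_unit s (nth 0%R h))); last first.
    by move=> x; apply: eq_first_unit => i si; rewrite nth_momv //; lia.
  transitivity (#|[pred h : (d + n1).-tuple R | first_unit s (nth 0%R h)]| *
      #|[pred b | W b]|)%N; last first.
    by rewrite -card_predX; apply: eq_card.
  rewrite cW !card_first_unit //; last by lia.
  rewrite mulnA [(#|R| ^ d * _)%N]mulnC -!mulnA -!expnD; do 2!congr (_ * _)%N.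
  by congr expn; lia.
have inj : {in D &, injective f}.
  move=> x y Dx Dy xy; have xyE i : (i < d + n1)%N -> mom x i = mom y i.
    by move=> id; rewrite -!nthf // xy.
  have x1 : x.1 = y.1.
    apply: (rec_inj Dx) => [i i1|l ld nw].
      transitivity (mom y (d + i) - mom x (d + i)).
        rewrite !mom_rec opprK addrC -sumrN -big_split /=; apply: eq_bigr => l _.
        by rewrite mulrBl xyE //; have := ltn_ord l; lia.
      by rewrite xyE ?subrr //; lia.
    by have := nthf2 x l ld; rewrite xy nthf2 // (negbTE nw).
  rewrite [x]surjective_pairing [y]surjective_pairing x1; congr pair.
  apply: (@momv_inj _ _ y.1) => i id; rewrite -{1}x1 -!surjective_pairing.
  by apply: xyE; lia.
have := @card_transport _ _ D T f FD FT inj DT cDT; rewrite {1}/D {1}/FD => ->.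
  rewrite -cW -card_predX; apply: eq_card => y; rewrite !inE /T /FT.
  by rewrite andbAC.
move=> x Dx; rewrite /FD /FT; congr F.
apply: (@eq_from_nth _ 0%R) => [|i]; rewrite size_mkseq ?size_tuple // => id.
by rewrite nth_mkseq // nthf.
Qed.

End Dependent.

Lemma forall_ord_recr n (P : nat -> bool) :
  [forall i : 'I_n.+1, P i] = [forall i : 'I_n, P i] && P n.
Proof.
apply/forallP/andP => [h|[/forallP h hn] i].
  split; last exact: (h ord_max).
  by apply/forallP => i; apply: (h (widen_ord (leqnSn n) i)).
have [ilt|] := ltnP i n; first exact: (h (Ordinal ilt)).
by move=> ni; rewrite (_ : (i : nat) = n) //; have := ltn_ord i; lia.
Qed.

Lemma first_unit_partition d (h : nat -> R) :
  (\sum_(s < d) (first_unit s h : nat) + [forall i : 'I_d, dv 1 (h i)] = 1)%N.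
Proof.
elim: d => [|d IH]; first by rewrite big_ord0 (_ : [forall i, _]) //; apply/forallP => -[].
rewrite big_ord_recr /= (forall_ord_recr d (fun i => dv 1 (h i))) -[RHS]IH -addnA; congr addn; rewrite /first_unit.
by case: (dv 1 (h d)); rewrite ?andbT ?andbF ?addn0.
Qed.

Lemma card_first_unit_partition d (P : pred (pairs R d)) :
  (#|[pred x | P x]| = \sum_(s < d) #|[pred x | first_unit s (mom x) & P x]| +
   #|[pred x | [forall i : 'I_d, dv 1 (mom x i)] & P x]|)%N.
Proof.
rewrite -(sum_nat_of_bool P).
rewrite -(sum_nat_of_bool (fun x : pairs R d => [forall i : 'I_d, dv 1 (mom x i)] && P x)).
rewrite [X in (X + _)%N](eq_bigr (fun s : 'I_d =>
    \sum_(x : pairs R d) (first_unit s (mom x) && P x : nat))%N); last first.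
  by move=> s _; rewrite -(sum_nat_of_bool (fun x : pairs R d => _ && P x)).
rewrite exchange_big -big_split /=; apply: eq_bigr => x _.
have := first_unit_partition d (mom x); case: (P x) => [e|_]; first rewrite -[LHS]e.
  by rewrite andbT; congr addn; apply: eq_bigr => s _; rewrite andbT.
by rewrite andbF addn0 big1 // => s _; rewrite andbF.
Qed.

(** All moments are multiples of [pi] exactly when [C] is. Each such [C] is [pi] times [q ^ d]
    polynomials, and the determinant loses a factor [pi ^+ e]. *)
Lemma count_all_dv d e n : (n <= N)%N ->
  (q ^ d * #|[pred x : pairs R d | [forall i : 'I_d, dv 1 (mom x i)]
     & dv n (\det (hankel e (mom x)))]| =
  #|[pred x : pairs R d | dv (n - e) (\det (hankel e (mom x)))]|)%N.
Proof.
move=> nN.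
have allE (x : pairs R d) : [forall i : 'I_d, dv 1 (mom x i)] = all (dv 1) x.2.
  have Am := mpoly_monic x.1.
  apply/forallP/(all_nthP 0) => [h|h].
    have : pi ^+ N.-1 *: Poly x.2 = 0.
      apply: (moments_eq0 Am (size_mpoly _)) => [|i id].
        by rewrite (leq_trans (size_scale_leq _ _)) // size_Poly_tuple.
      by rewrite momentZ //; apply/eqP; rewrite (dv_socle RC) (h (Ordinal id)).
    move=> h0 i _; rewrite -(dv_socle RC) -[x.2`_i]coef_Poly -coefZ h0 coef0.
    by [].
  have [p pE] : exists p, Poly x.2 = pi *: p.
    apply: poly_dv1 => i; rewrite coef_Poly.
    have [ix|ix] := ltnP i (size x.2); first exact: h.
    by rewrite nth_default // dv_0.
  by move=> i; rewrite /mom pE momentZ //; apply/dvP; exists (moment (mpoly d x.1) p i).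
pose f (a c : seq R) := dv n (\det (hankel e (moment (mpoly d a) (Poly c)))).
rewrite -(sum_nat_of_bool (fun x : pairs R d => _ && dv n _)).
rewrite -(sum_nat_of_bool (fun x : pairs R d => dv (n - e) _)).
rewrite -[in LHS](pair_bigA _ (fun a c : d.-tuple R =>
  nat_of_bool ([forall i : 'I_d, dv 1 (mom (a, c) i)] && f a c))) /=.
rewrite -[in RHS](pair_bigA _ (fun a c : d.-tuple R =>
  nat_of_bool (dv (n - e) (\det (hankel e (mom (a, c))))))) /=.
rewrite big_distrr; apply: eq_bigr => a _ /=.
transitivity (\sum_(c : d.-tuple R) nat_of_bool (f a (map ( *%R pi) c)))%N.
  rewrite (sum_tuple_mul_pi RC d (fun c => nat_of_bool (f a c))); congr (_ * _)%N.
  rewrite [RHS]big_mkcond; apply: eq_bigr => c _; rewrite allE /=.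
  by case: (all _ _).
apply: eq_bigr => c _; congr nat_of_bool; rewrite /f.
have -> : Poly (map ( *%R pi) c) = pi *: Poly c.
  apply/polyP => i; rewrite coefZ !coef_Poly.
  have [ic|ic] := ltnP i (size c); first by rewrite (nth_map 0).
  by rewrite !nth_default ?size_map // mulr0.
rewrite -(dv_pi RC e _ nN) -det_hankelZ; congr dv; congr (\det _).
by apply: eq_hankel => i _; rewrite momentZ ?mpoly_monic.
Qed.

End Recursion.

(** * Recursion for the tails of the Hankel determinant *)

Section Density.
Variables (R : finComNzRingType) (pi : R) (N q : nat).
Hypothesis RC : chain_ring pi N q.
Variable K : numFieldType.
Local Notation dv := (dv pi).
Local Notation cM := (cardM pi).
Local Notation first_unit := (first_unit pi).
Local Notation M := (#|R|%:R : K).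
Local Notation z := (q%:R^-1 : K).

Definition pair_density d e n : K :=
  #|[pred x : pairs R d | dv n (\det (hankel e (mom x)))]|%:R / (M ^+ d) ^+ 2.

Definition hankel_density e n : K :=
  #|[pred h : ((e + e).-1).-tuple R | dv n (\det (hankel e (nth 0%R h)))]|%:R /
  M ^+ (e + e).-1.

Lemma M_neq0 : M != 0.
Proof.
rewrite pnatr_eq0 (chain_card RC) -lt0n expn_gt0.
by rewrite ltnW ?(chain_residue RC).
Qed.

Lemma q_neq0 : (q%:R : K) != 0.
Proof. by rewrite pnatr_eq0 -lt0n ltnW ?(chain_residue RC). Qed.

Lemma cME : cM%:R = M * z.
Proof. by rewrite (card_chain RC) natrM mulrAC mulfV ?q_neq0 // mul1r. Qed.

Lemma card_unitsE : (#|R| - cM)%:R = M * (1 - z).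
Proof. by rewrite natrB ?cME; [ring|apply: max_card]. Qed.

(** The Hankel matrix sees only the first [2e - 1] moments, which are uniform when they number at
    most [d]. *)
Lemma pair_density_hankel d e n : ((e + e).-1 <= d)%N ->
  pair_density d e n = hankel_density e n.
Proof.
move=> ed; rewrite /pair_density /hankel_density.
have [v dE] : exists v, d = ((e + e).-1 + v)%N by exists (d - (e + e).-1)%N; lia.
subst d; set w := (e + e).-1.
rewrite (card_momv (F := fun h => dv n (\det (hankel e (nth 0%R (take w h)))))).
  rewrite (card_tuple_take w v (fun h => dv n (\det (hankel e (nth 0%R h))))).
  rewrite !natrM !natrX exprD; have M0 := M_neq0.
  by field; rewrite !expf_neq0.
move=> x; congr dv; congr (\det _); apply: eq_hankel => i ie.
by rewrite nth_take // nth_momv // ltn_addr.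
Qed.

Lemma small_step_density s d e n : (s < e)%N -> (e <= d)%N ->
  #|[pred x : pairs R d | first_unit s (mom x)
      & dv n (\det (hankel e (mom x)))]|%:R / (M ^+ d) ^+ 2 =
  (1 - z) * z ^+ s * pair_density (d - s.+1) (e - s.+1) n.
Proof.
move=> se ed; rewrite /pair_density.
have [m dE] : exists m, d = (s.+1 + m)%N by exists (d - s.+1)%N; lia.
have [t eE] : exists t, e = (s.+1 + t)%N by exists (e - s.+1)%N; lia.
subst d e; rewrite !addKn (count_small_step RC) !natrM !natrX card_unitsE cME.
have M0 := M_neq0; have q0 := q_neq0; rewrite exprD exprMn exprS.
by field; rewrite q0 !expf_neq0.
Qed.

Lemma large_step_density s d e n : (e <= s)%N -> (s < d)%N ->
  (d <= (e + e).-1)%N -> (n <= N)%N ->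
  #|[pred x : pairs R d | first_unit s (mom x)
      & dv n (\det (hankel e (mom x)))]|%:R / (M ^+ d) ^+ 2 =
  (1 - z) * z ^+ s * hankel_density (s.+1 - e) (n - (s.+1 - e)).
Proof.
move=> es sd de nN.
have [k kE] : exists k, k = (s.+1 - e)%N by exists (s.+1 - e)%N.
have [r rE] : exists r, e = (r.+1 + k)%N by exists (e - k).-1; lia.
have [w wE] : exists w, w = (k + k).-1 by exists (k + k).-1.
(* [n1] counts the entries, among the [2e - 1] of the Hankel matrix, that lie beyond the first [d]
   moments. *)
have [n1 n1E] : exists n1, (d + n1 = r.+1 + (w + r.+1))%N.
  by exists ((e + e).-1 - d)%N; lia.
have sE : s = (w + r.+1)%N by lia.
have k0 : (0 < k)%N by lia.
rewrite -kE.
have -> : #|[pred x : pairs R d | first_unit s (mom x)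
      & dv n (\det (hankel e (mom x)))]| =
    #|[pred x : pairs R d | first_unit s (mom x)
      & dv n (\det (hankel e (nth 0%R (mkseq (mom x) (d + n1)))))]|.
  apply: eq_card => x; rewrite !inE; congr andb.
  congr dv; congr (\det _); apply: eq_hankel => i ie; rewrite nth_mkseq //; lia.
rewrite (card_first_unit_dependent RC (n1 := n1) sd _
  (fun h => dv n (\det (hankel e (nth 0%R h))))); last by lia.
have step := count_large_step RC r n k0.
have shift : (q ^ w * #|[pred t : w.-tuple R | all (dv 1) t
      & dv n (\det (hankel k (nth 0%R t)))]| =
    #|[pred t : w.-tuple R | dv (n - k) (\det (hankel k (nth 0%R t)))]|)%N.
  rewrite (card_tuple_mul_pi RC w (fun t => dv n (\det (hankel k (nth 0%R t))))).
  by apply: eq_card => t; rewrite !inE det_hankel_map (dv_pi RC).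
move: shift step; rewrite /hankel_density -wE sE n1E rE.
set X1 := #|[pred h : (_ + _).-tuple R | _]|.
set X2 := #|[pred t : w.-tuple R | all (dv 1) t & _]|.
set X3 := #|[pred t : w.-tuple R | _]|.
move=> /(congr1 (fun x => x%:R : K)) shift /(congr1 (fun x => x%:R : K)) step.
move: shift step; rewrite !natrM !natrX card_unitsE cME => shift step.
have M0 := M_neq0; have q0 := q_neq0.
have X1E : X1%:R = (M * z) ^+ r.+1 * (M * (1 - z) * M ^+ r) *
    (M ^+ (w + r.+1) * (M ^+ r.+1 * X2%:R)) / M ^+ (r.+1 + (w + r.+1)).
  by apply: (mulfI (expf_neq0 (r.+1 + (w + r.+1)) M0)); rewrite step; field; rewrite expf_neq0.
have dE : M ^+ (d - n1) * M ^+ (r.+1 + (w + r.+1)) = (M ^+ d) ^+ 2.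
  by rewrite -exprD -exprM; congr (_ ^+ _); lia.
rewrite -dE X1E -shift; move: (M ^+ (d - n1)) (expf_neq0 (d - n1) M0) => Md Md0.
rewrite !exprD !exprS !exprMn !exprVn.
by field; rewrite Md0 q0 M0 !expf_neq0.
Qed.

Lemma all_dv_density d e n : (n <= N)%N ->
  #|[pred x : pairs R d | [forall i : 'I_d, dv 1 (mom x i)]
      & dv n (\det (hankel e (mom x)))]|%:R / (M ^+ d) ^+ 2 =
  z ^+ d * pair_density d e (n - e).
Proof.
move=> nN; rewrite /pair_density -(count_all_dv RC d e nN) natrM natrX.
have M0 := M_neq0; have q0 := q_neq0.
by rewrite exprVn; field; rewrite !expf_neq0.
Qed.

(** The conditional tail given a first unit of index [s], an event of probability
    [(1 - z) * z ^+ s]. *)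
Definition step_density d e n s : K := if (s < e)%N
  then pair_density (d - s.+1) (e - s.+1) n
  else hankel_density (s.+1 - e) (n - (s.+1 - e)).

Lemma pair_density_rec d e n : (e <= d)%N -> (d <= e + e)%N -> (n <= N)%N ->
  pair_density d e n = \sum_(s < d) (1 - z) * z ^+ s * step_density d e n s +
    z ^+ d * pair_density d e (n - e).
Proof.
move=> ed d2e nN.
have main d' : (e <= d')%N -> (d' <= (e + e).-1)%N ->
    pair_density d' e n = \sum_(s < d') (1 - z) * z ^+ s * step_density d' e n s +
    z ^+ d' * pair_density d' e (n - e).
  move=> ed' d'e; rewrite -all_dv_density // {1}/pair_density.
  rewrite (card_first_unit_partition pi) natrD mulrDl; congr (_ + _).
  rewrite natr_sum mulr_suml; apply: eq_bigr => s _; rewrite /step_density.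
  case: ltnP => se; first by rewrite small_step_density.
  by rewrite large_step_density.
(* The bound [d <= 2e] exceeds that of [main] by one, because [pair_density_step] needs the
   recursion at [(d - 1, e - 1)] as well. The case [d = 2e] follows from [d = 2e - 1], where the
   density is the same. *)
have [d1|d1] := leqP d (e + e).-1; first exact: main.
have {d1 d2e} -> : d = (e + e)%N by lia.
have [->|e0] := posnP e; first by rewrite big_ord0 add0r mul1r subn0.
have [w wE] : exists w, w = (e + e).-1 by exists (e + e).-1.
have -> : (e + e = w.+1)%N by lia.
rewrite !(@pair_density_hankel w.+1) -?wE //.
rewrite -(@pair_density_hankel w e n) -?wE // main -?wE //; last by lia.
rewrite big_ord_recr /= [X in _ = _ + X + _](_ : _ =
   (1 - z) * z ^+ w * hankel_density e (n - e)); last first.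
  by rewrite /step_density ifF; [congr (_ * hankel_density _ (_ - _)%N); lia|lia].
rewrite pair_density_hankel -?wE // exprS -addrA; congr (_ + _); last by ring.
apply: eq_bigr => s _; congr (_ * _); rewrite /step_density.
by case: ltnP => // se; rewrite !pair_density_hankel //; lia.
Qed.

Lemma pair_density_step d e n : (0 < e)%N -> (e <= d)%N -> (d <= (e + e).-1)%N ->
  (n <= N)%N ->
  pair_density d e n = pair_density d.-1 e.-1 n +
    z ^+ d * (pair_density d e (n - e) - pair_density d.-1 e.-1 (n - e.-1)).
Proof.
case: e => // e _; case: d => // d ed de nN /=.
rewrite pair_density_rec //; last by lia.
rewrite big_ord_recl /= expr0 mulr1 {1}/step_density /= !subn1 /=.
(* [step_density] is unchanged when [d], [e] and [s] all drop by one, so the rest of the sum is [z]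
   times the sum for [(d, e)], which the recursion expresses by [pair_density]. *)
have -> : \sum_(i < d) (1 - z) * z ^+ (bump 0 i) * step_density d.+1 e.+1 n (bump 0 i)
    = z * (pair_density d e n - z ^+ d * pair_density d e (n - e)).
  rewrite [in RHS]pair_density_rec //; last by lia.
  rewrite addrK mulr_sumr; apply: eq_bigr => s _.
  rewrite /bump /= add1n exprS /step_density ltnS !subSS; ring.
by rewrite exprS; ring.
Qed.

End Density.

(** * Sums of minima *)

Section Windows.
Local Open Scope nat_scope.
Variable N : nat.

Definition wmin a b (y : nat -> nat) : nat := \big[minn/N]_(a <= l < b) y l.

(* The sum [Y_j] of the theorem, with [e = d - j], [y l = X_(d-1-l)] and every
   minimum capped at [N]. *)
Definition ysum d e (y : nat -> nat) : nat :=
  \sum_(i < e) wmin (e - i.+1) (minn d (e + i)) y.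

Lemma eq_wmin a b y y' : (forall l, l < b -> y l = y' l) -> wmin a b y = wmin a b y'.
Proof.
move=> yy; rewrite /wmin big_seq [RHS]big_seq; apply: eq_bigr => l.
by rewrite mem_index_iota => /andP[_ lb]; apply: yy.
Qed.

Lemma wmin_le a b y l : a <= l < b -> wmin a b y <= y l.
Proof.
move=> lab; have : l \in index_iota a b by rewrite mem_index_iota.
rewrite /wmin; elim: (index_iota a b) => //= x s IH; rewrite inE big_cons.
case/orP=> [/eqP<-|/IH le]; first exact: geq_minl.
by rewrite (leq_trans _ le) ?geq_minr.
Qed.

Lemma wmin_shift a b y : wmin a.+1 b.+1 y = wmin a b (fun l => y l.+1).
Proof. by rewrite /wmin big_add1. Qed.

Lemma wmin_succ a b y :
  wmin a b (fun l => minn N (y l).+1) = minn N (wmin a b y).+1.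
Proof.
rewrite /wmin; elim: (index_iota a b) => [|x s IH]; first by rewrite !big_nil; lia.
by rewrite !big_cons IH; lia.
Qed.

Lemma eq_ysum d e y y' : (forall l, l < minn d (e + e).-1 -> y l = y' l) ->
  ysum d e y = ysum d e y'.
Proof.
move=> yy; apply: eq_bigr => i _; apply: eq_wmin => l ll; apply: yy.
by have := ltn_ord i; lia.
Qed.

Lemma ysum_large d e y : (e + e).-1 <= d -> ysum d e y = ysum (e + e).-1 e y.
Proof.
move=> ed; apply: eq_bigr => i _; congr wmin; have := ltn_ord i; lia.
Qed.

(** When [d <= 2e] the widest window, [i = e], contains all the variables; the others miss variable
    0 and are the windows of [(d, e)] shifted by one. *)
Lemma ysumS d e y : d <= e + e ->
  ysum d.+1 e.+1 y = ysum d e (fun l => y l.+1) + wmin 0 d.+1 y.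
Proof.
move=> de; rewrite /ysum big_ord_recr /= subnn (_ : minn d.+1 _ = d.+1); last by lia.
congr addn; apply: eq_bigr => i _; rewrite -wmin_shift; congr wmin.
  by have := ltn_ord i; lia.
by lia.
Qed.

Lemma leq_sum_cap n e (f : 'I_e -> nat) : n <= N ->
  (n <= \sum_(i < e) minn N (f i)) = (n <= \sum_(i < e) f i).
Proof.
move=> nN; have [/existsP[i Ni]|/existsPn h] := boolP [exists i, N <= f i].
  rewrite (bigD1 i) //= [in RHS](bigD1 i) //=.
  by transitivity true; [|symmetry]; lia.
congr (_ <= _); apply: eq_bigr => i _; apply/minn_idPr.
by have := h i; rewrite -ltnNge => /ltnW.
Qed.

(** Memorylessness in deterministic form: raising every variable by 1 raises each of the [e] minima
    by 1, and the cap is invisible to tails up to [N]. *)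
Lemma leq_ysum_succ n d e y : n <= N ->
  (n <= ysum d e (fun l => minn N (y l).+1)) = (n - e <= ysum d e y).
Proof.
move=> nN; rewrite /ysum.
under eq_bigr => i _ do rewrite wmin_succ.
rewrite leq_sum_cap //.
under eq_bigr => i _ do rewrite -addn1.
by rewrite big_split /= sum_nat_const card_ord muln1 leq_subLR addnC.
Qed.

End Windows.

(** * The same recursion for the sums of minima *)

Section WindowDensity.
Variables (R : finComNzRingType) (pi : R) (N q : nat).
Hypothesis RC : chain_ring pi N q.
Variable K : numFieldType.
Local Notation dv := (dv pi).
Local Notation cM := (cardM pi).
Local Notation M := (#|R|%:R : K).
Local Notation z := (q%:R^-1 : K).

(* The valuation, with value [N] at [0]. *)
Definition rval (x : R) : nat := (\max_(n < N.+1 | dv n x) n)%N.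

Lemma rval_le x : (rval x <= N)%N.
Proof. by apply/bigmax_leqP => n _; rewrite -ltnS. Qed.

Lemma leq_rval n x : (n <= N)%N -> (n <= rval x)%N = dv n x.
Proof.
move=> nN; apply/idP/idP => [|dn]; last first.
  have nN1 : (n < N.+1)%N by [].
  exact: (@leq_bigmax_cond _ (fun m : 'I_N.+1 => dv m x) (fun m => m : nat)
    (Ordinal nN1)).
case: n nN => [|n] nN; first by rewrite dv0.
have [m dm ->] : exists2 m : 'I_N.+1, dv m x & rval x = m.
  have : (0 < #|[pred m : 'I_N.+1 | dv m x]|)%N.
    by apply/card_gt0P; exists ord0; rewrite inE dv0.
  by case/(eq_bigmax_cond (fun m : 'I_N.+1 => m : nat)) => m dm E; exists m.
move=> nm; have /dvP[y ->] := dm; apply/dvP; exists (pi ^+ (m - n.+1) * y).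
by rewrite mulrA -exprD subnKC.
Qed.

Lemma rval_pi x : rval (pi * x) = minn N (rval x).+1.
Proof.
have le n : (n <= N)%N -> (n <= rval (pi * x)%R)%N = (n <= (rval x).+1)%N.
  move=> nN; rewrite leq_rval // -[pi in pi * x]expr1 (dv_pi RC) //.
  by rewrite -leq_rval; lia.
apply/eqP; rewrite eqn_leq leq_min rval_le /=.
by rewrite -le ?rval_le // leqnn le ?geq_minl // geq_minr.
Qed.

Definition rvals (t : seq R) (i : nat) : nat := rval (nth 0%R t i).

Lemma rvals_mul_pi t i : rvals (map ( *%R pi) t) i = minn N (rvals t i).+1.
Proof.
rewrite /rvals -rval_pi; congr rval.
have [it|ti] := ltnP i (size t); first by rewrite (nth_map 0).
by rewrite !nth_default ?size_map // mulr0.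
Qed.

(** The tail of [Y_j] with its variables replaced by the valuations of [d] independent uniform
    elements of [R], which have the geometric law capped at [N]. *)
Definition window_density d e n : K :=
  #|[pred t : d.-tuple R | n <= ysum N d e (rvals t)]%N|%:R / M ^+ d.

Lemma window_density_large d e n : ((e + e).-1 <= d)%N ->
  window_density d e n = window_density (e + e).-1 e n.
Proof.
move=> ed; have [v dE] : exists v, d = ((e + e).-1 + v)%N.
  by exists (d - (e + e).-1)%N; lia.
subst d; set w := (e + e).-1 in ed *; rewrite /window_density.
have -> : #|[pred t : (w + v).-tuple R | n <= ysum N (w + v) e (rvals t)]%N| =
    #|[pred t : (w + v).-tuple R | n <= ysum N w e (rvals (take w t))]%N|.
  apply: eq_card => t; rewrite !inE ysum_large // -/w; congr (_ <= _)%N.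
  by apply: eq_ysum => l lw; rewrite /rvals nth_take // -/w; lia.
rewrite (card_tuple_take w v (fun t => n <= ysum N w e (rvals t))%N) natrM natrX.
have M0 := M_neq0 RC K.
by rewrite exprD; field; rewrite !expf_neq0.
Qed.

(** If some entry is a unit, the minimum of all the variables is 0 and the sums for [(d, e)] and
    [(d - 1, e - 1)] agree. If all entries are multiples of [pi], dividing by [pi] lowers the two
    thresholds by [e] and [e - 1]. *)
Lemma window_density_step d e n : (0 < e)%N -> (e <= d)%N ->
  (d <= (e + e).-1)%N -> (n <= N)%N ->
  window_density d e n = window_density d.-1 e.-1 n +
    z ^+ d * (window_density d e (n - e) - window_density d.-1 e.-1 (n - e.-1)).
Proof.
case: e => // e _; case: d => // d ed de nN /=.
have {}de : (d <= e + e)%N by lia.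
pose Y n (t : seq R) := (n <= ysum N d.+1 e.+1 (rvals t))%N.
pose Y' n (t : seq R) := (n <= ysum N d e (rvals (behead t)))%N.
have cY' m : #|[pred t : d.+1.-tuple R | Y' m t]| =
    (#|R| * #|[pred t : d.-tuple R | m <= ysum N d e (rvals t)]%N|)%N.
  rewrite -(sum_nat_of_bool (fun t : d.+1.-tuple R => Y' m t)).
  rewrite (sum_tupleS _ (fun t => nat_of_bool (Y' m t))) /Y' /= sum_nat_const.
  by congr (_ * _)%N; rewrite -(sum_nat_of_bool (fun t : d.-tuple R => _ <= _)%N).
have allY : (q ^ d.+1 * #|[pred t : d.+1.-tuple R | all (dv 1) t & Y n t]| =
    #|[pred t : d.+1.-tuple R | Y (n - e.+1)%N t]|)%N.
  rewrite (card_tuple_mul_pi RC d.+1 (Y n)); apply: eq_card => t; rewrite !inE.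
  rewrite /Y -leq_ysum_succ //; congr (_ <= _)%N; apply: eq_ysum => l _.
  exact: rvals_mul_pi.
have allY' : (q ^ d.+1 * #|[pred t : d.+1.-tuple R | all (dv 1) t & Y' n t]| =
    #|[pred t : d.+1.-tuple R | Y' (n - e)%N t]|)%N.
  rewrite (card_tuple_mul_pi RC d.+1 (Y' n)); apply: eq_card => t; rewrite !inE.
  rewrite /Y' -leq_ysum_succ // behead_map; congr (_ <= _)%N.
  apply: eq_ysum => l _; exact: rvals_mul_pi.
have split : (#|[pred t : d.+1.-tuple R | Y n t]| +
     #|[pred t : d.+1.-tuple R | all (dv 1) t & Y' n t]| =
     #|[pred t : d.+1.-tuple R | all (dv 1) t & Y n t]| +
     #|[pred t : d.+1.-tuple R | Y' n t]|)%N.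
  rewrite -(sum_nat_of_bool (fun t : d.+1.-tuple R => Y n t)).
  rewrite -(sum_nat_of_bool (fun t : d.+1.-tuple R => Y' n t)).
  rewrite -(sum_nat_of_bool (fun t : d.+1.-tuple R => all (dv 1) t && Y n t)).
  rewrite -(sum_nat_of_bool (fun t : d.+1.-tuple R => all (dv 1) t && Y' n t)).
  rewrite -!big_split /=; apply: eq_bigr => t _.
  case: (boolP (all (dv 1) t)) => [_|/allPn[x xt ndv]] /=; first by rewrite addnC.
  rewrite addn0 add0n; congr nat_of_bool; rewrite /Y /Y'; congr (_ <= _)%N.
  rewrite ysumS // [X in (_ + X)%N](_ : _ = 0%N).
    by rewrite addn0; apply: eq_ysum => l _; rewrite /rvals nth_behead.
  apply/eqP; rewrite -leqn0.
  have it : (index x t < d.+1)%N by have := xt; rewrite -index_mem size_tuple.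
  rewrite (leq_trans (wmin_le N (rvals t) (_ : 0 <= index x t < d.+1)%N)) //.
  rewrite /rvals nth_index // leqNgt leq_rval //.
  exact: chain_length RC.
rewrite /window_density.
move: split allY allY'; rewrite /Y !cY'.
set a := #|[pred t : d.+1.-tuple R | n <= _]%N|.
set b := #|[pred t : d.+1.-tuple R | all _ _ & Y' n t]|.
set c := #|[pred t : d.+1.-tuple R | all _ _ & _ <= _]%N|.
set f := #|[pred t : d.-tuple R | n <= _]%N|.
set g := #|[pred t : d.+1.-tuple R | n - e.+1 <= _]%N|.
set h := #|[pred t : d.-tuple R | n - e <= _]%N|.
move=> /(congr1 (fun x => x%:R : K)) E1 /(congr1 (fun x => x%:R : K)) E2.
move=> /(congr1 (fun x => x%:R : K)) E3.
move: E1 E2 E3; rewrite !natrM !natrD !natrX natrM => E1 E2 E3.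
have M0 := M_neq0 RC K; have q0 := q_neq0 RC K.
have -> : a%:R = c%:R + M * f%:R - b%:R by rewrite -E1 addrK.
have -> : c%:R = z ^+ d.+1 * g%:R.
  by rewrite -E2 exprVn mulKf // expf_neq0.
have -> : b%:R = z ^+ d.+1 * (M * h%:R).
  by rewrite -E3 exprVn mulKf // expf_neq0.
rewrite !exprS !exprVn; field; rewrite M0 q0 !expf_neq0 //.
Qed.

Lemma window_density0 d n : window_density d 0 n = (n == 0%N)%:R.
Proof.
rewrite /window_density.
have -> : #|[pred t : d.-tuple R | n <= ysum N d 0 (rvals t)]%N| =
    ((n == 0) * #|R| ^ d)%N.
  rewrite -card_tuple; case: eqVneq => [->|n0].
    by rewrite mul1n; apply: eq_card => t; rewrite !inE.
  by rewrite mul0n; apply: eq_card0 => t; rewrite !inE /ysum big_ord0 leqn0 (negbTE n0).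
by rewrite natrM natrX mulfK // expf_neq0 // (M_neq0 RC).
Qed.

Lemma pair_density0 d n : (n <= N)%N -> pair_density pi K d 0 n = (n == 0%N)%:R.
Proof.
move=> nN; rewrite /pair_density.
have -> : #|[pred x : pairs R d | dv n (\det (hankel 0 (mom x)))]| =
    ((n == 0) * (#|R| ^ d * #|R| ^ d))%N.
  rewrite -!card_tuple -card_prod.
  case: eqVneq => [->|n0].
    by rewrite mul1n; apply: eq_card => t; rewrite !inE dv0.
  rewrite mul0n; apply: eq_card0 => t; rewrite !inE det_mx00.
  by rewrite (dv_one_gt0 RC) // (negbTE n0).
by rewrite !natrM !natrX -expr2 mulfK // !expf_neq0 // (M_neq0 RC).
Qed.

(* Both densities satisfy the same two-term recursion. *)
Lemma pair_density_window d e n : (e <= d)%N -> (n <= N)%N ->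
  pair_density pi K d e n = window_density d e n.
Proof.
elim: e d n => [|e IHe] d n ed nN.
  by rewrite pair_density0 // window_density0.
(* The recursion also calls the same [e] at a lower threshold, hence an inner induction on [n]. *)
elim/ltn_ind: n d ed nN => n IHn d ed nN.
wlog d2e : d ed / (d <= (e.+1 + e.+1).-1)%N.
  move=> W; have [de|de] := leqP d (e.+1 + e.+1).-1; first exact: W.
  rewrite (pair_density_hankel RC) ?(ltnW de) // window_density_large ?(ltnW de) //.
  by rewrite -W ?(pair_density_hankel RC) //; lia.
rewrite (pair_density_step RC) // window_density_step //=.
rewrite !IHe //; try lia; congr (_ + _ * (_ - _)).
(* At [n = 0] the threshold does not drop, but both tails are 1. *)
have [->|n0] := posnP n; last by apply: IHn; lia.
rewrite sub0n /pair_density /window_density.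
have M0 := M_neq0 RC K.
have -> : #|[pred x : pairs R d | dv 0 (\det (hankel e.+1 (mom x)))]| =
    (#|R| ^ d * #|R| ^ d)%N.
  by rewrite -!card_tuple -card_prod; apply: eq_card => t; rewrite !inE dv0.
have -> : #|[pred t : d.-tuple R | 0 <= ysum N d e.+1 (rvals t)]%N| = (#|R| ^ d)%N.
  by rewrite -card_tuple; apply: eq_card => t; rewrite !inE.
by rewrite natrM natrX -expr2 !mulfV ?expf_neq0.
Qed.

End WindowDensity.

(** * Finite quotients of a discrete valuation ring *)

Record finite_quotient (W : comNzRingType) := FiniteQuotient {
  fq_ideal : W -> Prop;
  fq_idealD : forall x y, fq_ideal x -> fq_ideal y -> fq_ideal (x + y);
  fq_idealM : forall a x, fq_ideal x -> fq_ideal (a * x);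
  fq_proper : ~ fq_ideal 1;
  fq_sort : finType;
  fq_red : W -> fq_sort;
  fq_rep : fq_sort -> W;
  fq_repK : cancel fq_rep fq_red;
  fq_redP : forall x y, fq_red x = fq_red y <-> fq_ideal (x - y) }.

Definition quotient_ring (W : comNzRingType) (S : finite_quotient W) : Type :=
  fq_sort S.

Section QuotientRing.
Variables (W : comNzRingType) (S : finite_quotient W).
Local Notation T := (quotient_ring S).
Local Notation I := (fq_ideal S).

Definition proj (x : W) : T := fq_red S x.
Definition repr (t : T) : W := fq_rep t.

HB.instance Definition _ := Finite.copy T (fq_sort S).

Lemma reprK : cancel repr proj.
Proof. exact: fq_repK. Qed.

Lemma projP x y : proj x = proj y <-> I (x - y).
Proof. exact: fq_redP. Qed.

Let repr_proj x : I (repr (proj x) - x).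
Proof. by apply/projP; rewrite reprK. Qed.

Let qadd (a b : T) : T := proj (repr a + repr b).
Let qopp (a : T) : T := proj (- repr a).
Let qmul (a b : T) : T := proj (repr a * repr b).

Let qaddE x y : qadd (proj x) (proj y) = proj (x + y).
Proof.
apply/projP; rewrite [X in I X](_ : _ =
  (repr (proj x) - x) + (repr (proj y) - y)); last by ring.
by apply: fq_idealD; apply: repr_proj.
Qed.

Let qoppE x : qopp (proj x) = proj (- x).
Proof.
apply/projP; rewrite [X in I X](_ : _ = - 1 * (repr (proj x) - x)); last by ring.
by apply: fq_idealM; apply: repr_proj.
Qed.

Let qmulE x y : qmul (proj x) (proj y) = proj (x * y).
Proof.
apply/projP; rewrite [X in I X](_ : _ = repr (proj y) * (repr (proj x) - x) +
   x * (repr (proj y) - y)); last by ring.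
by apply: fq_idealD; apply: fq_idealM; apply: repr_proj.
Qed.

Let qaddA : associative qadd.
Proof.
move=> a b c; rewrite -(reprK a) -(reprK b) -(reprK c) !qaddE.
by rewrite addrA.
Qed.

Let qaddC : commutative qadd.
Proof. by move=> a b; rewrite -(reprK a) -(reprK b) !qaddE addrC. Qed.

Let qadd0 : left_id (proj 0) qadd.
Proof. by move=> a; rewrite -(reprK a) !qaddE add0r. Qed.

Let qaddN : left_inverse (proj 0) qopp qadd.
Proof. by move=> a; rewrite -(reprK a) qoppE !qaddE addNr. Qed.

HB.instance Definition _ := GRing.isZmodule.Build T qaddA qaddC qadd0 qaddN.

Let qmulA : associative qmul.
Proof.
by move=> a b c; rewrite -(reprK a) -(reprK b) -(reprK c) !qmulE mulrA.
Qed.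

Let qmulC : commutative qmul.
Proof. by move=> a b; rewrite -(reprK a) -(reprK b) !qmulE mulrC. Qed.

Let qmul1 : left_id (proj 1) qmul.
Proof. by move=> a; rewrite -(reprK a) !qmulE mul1r. Qed.

Let qmulDl : left_distributive qmul +%R.
Proof.
move=> a b c; rewrite -(reprK a) -(reprK b) -(reprK c).
by rewrite -[_ + _]/(qadd _ _) -[RHS]/(qadd _ _) !(qmulE, qaddE) mulrDl.
Qed.

Let qone0 : proj 1 != 0 :> T.
Proof. by apply/eqP => /projP; rewrite subr0; apply: fq_proper. Qed.

HB.instance Definition _ :=
  GRing.Zmodule_isComNzRing.Build T qmulA qmulC qmul1 qmulDl qone0.

Lemma proj_is_zmod_morphism : zmod_morphism proj.
Proof. by move=> x y; rewrite -[RHS]/(qadd _ (qopp _)) qoppE qaddE. Qed.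

Lemma proj_is_monoid_morphism : monoid_morphism proj.
Proof. by split=> // x y; rewrite -[RHS]/(qmul _ _) qmulE. Qed.

HB.instance Definition _ :=
  GRing.isZmodMorphism.Build W T proj proj_is_zmod_morphism.
HB.instance Definition _ :=
  GRing.isMonoidMorphism.Build W T proj proj_is_monoid_morphism.

End QuotientRing.

Section DVR.
Variable W : idomainType.
Variables (q : nat) (pi : W).
Hypothesis pi_neq0 : pi != 0.
Hypothesis nonunitP : forall x : W, x \isn't a GRing.unit <-> exists y, x = pi * y.
Variables (res : W -> 'I_q) (lift : 'I_q -> W).
Hypothesis liftK : cancel lift res.
Hypothesis resP : forall x y, res x = res y <-> exists w, x - y = pi * w.

Definition pidv n (x : W) : Prop := exists y, x = pi ^+ n * y.

Lemma pidv_cancel k n x : (k <= n)%N -> pidv n (pi ^+ k * x) -> pidv (n - k) x.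
Proof.
move=> kn [y]; rewrite -{1}(subnKC kn) exprD -mulrA.
by move/(mulfI (expf_neq0 k pi_neq0)) => ->; exists y.
Qed.

Lemma pidvD n x y : pidv n x -> pidv n y -> pidv n (x + y).
Proof. by move=> [u ->] [v ->]; exists (u + v); rewrite mulrDr. Qed.

Lemma pidvM n a x : pidv n x -> pidv n (a * x).
Proof. by move=> [u ->]; exists (a * u); rewrite mulrCA. Qed.

Lemma pidv1 n : pidv n.+1 1 -> False.
Proof.
move=> [y e]; have : (1 : W) \isn't a GRing.unit.
  by apply/nonunitP; exists (pi ^+ n * y); rewrite mulrA -exprS.
by rewrite unitr1.
Qed.

(** Expansion in base [pi]: from [x = lift (res x) + pi * quo x], a class modulo [pi ^+ n.+1] is a
    digit in ['I_q] and a class modulo [pi ^+ n]. *)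
Lemma digits_exist n : exists (T : finType) (red : W -> T) (rep : T -> W),
  [/\ #|T| = (q ^ n)%N, cancel rep red &
      forall x y, red x = red y <-> pidv n (x - y)].
Proof.
elim: n => [|n [T [red [rep [cT repK redP]]]]].
  exists unit, (fun=> tt), (fun=> 0); split=> [|[]|x y] //.
    by rewrite card_unit.
  by split=> // _; exists (x - y); rewrite mul1r.
have quoE x : {y | x - lift (res x) = pi * y}.
  by apply: boolp.cid; apply/resP; rewrite liftK.
pose quo x := sval (quoE x).
have quoP x : x = lift (res x) + pi * quo x.
  by rewrite -(svalP (quoE x)) addrC subrK.
exists ('I_q * T)%type, (fun x => (res x, red (quo x))).
exists (fun u => lift u.1 + pi * rep u.2); split.
- by rewrite card_prod card_ord cT expnS.
- move=> [i t] /=; set x := lift i + _.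
  have rx : res x = i.
    by rewrite -[RHS]liftK; apply/resP; exists (rep t); rewrite /x addrC addKr.
  congr pair => //; rewrite -[RHS]repK; congr red.
  by have := quoP x; rewrite rx => /addrI /(mulfI pi_neq0) <-.
have subE x y : res x = res y -> x - y = pi * (quo x - quo y).
  move=> rxy; transitivity (lift (res x) + pi * quo x - (lift (res y) + pi * quo y)).
    by rewrite -!quoP.
  by rewrite rxy; ring.
move=> x y; split=> [[rxy /redP[w e]]|[w e]].
  by exists w; rewrite subE // e exprS mulrA.
have rxy : res x = res y by apply/resP; exists (pi ^+ n * w); rewrite mulrA -exprS.
congr pair => //; apply/redP; exists w; apply: (mulfI pi_neq0).
by rewrite mulrA -exprS -e (subE x y).
Qed.

Lemma finite_quotient_exists n : (0 < n)%N -> exists S : finite_quotient W,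
  (forall x, fq_ideal S x <-> pidv n x) /\ #|{: quotient_ring S}| = (q ^ n)%N.
Proof.
case: n => // n _; have [T [red [rep [cT repK redP]]]] := digits_exist n.+1.
pose S := FiniteQuotient (@pidvD n.+1) (@pidvM n.+1) (@pidv1 n) repK redP; exists S.
split=> [x|]; first by split.
rewrite -cT; have : bijective (fun x : quotient_ring S => x : T) by exists id.
exact: bij_eq_card.
Qed.

Lemma quotient_dvP n S k x : (forall x, fq_ideal S x <-> pidv n x) -> (k <= n)%N ->
  dv (proj S pi) k (proj S x) <-> pidv k x.
Proof.
move=> SI kn; split=> [/dvP[t]|[y ->]]; last first.
  by apply/dvP; exists (proj S y); rewrite rmorphM rmorphXn.
rewrite -(reprK t) -rmorphXn -rmorphM => /projP /SI[w e].
exists (repr t + pi ^+ (n - k) * w).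
by rewrite mulrDr mulrA -exprD subnKC // -e addrC subrK.
Qed.

Lemma quotient_chain_ring n S : (0 < n)%N -> (forall x, fq_ideal S x <-> pidv n x) ->
  #|{: quotient_ring S}| = (q ^ n)%N -> chain_ring (proj S pi) n q.
Proof.
move=> n0 SI cS; have dvE k x (kn : (k <= n)%N) := quotient_dvP x SI kn.
have q1 : (1 < q)%N.
  have : res 0 != res 1.
    apply/eqP => /resP[w e]; have : (1 : W) \isn't a GRing.unit.
      by apply/nonunitP; exists (- w); rewrite mulrN -e sub0r opprK.
    by rewrite unitr1.
  case: (res 0) (res 1) => [i iq] [k kq]; rewrite -val_eqE /=.
  by case: q iq kq => [|[|?]] // ; case: i k => [|?] [|?].
split=> //.
(* The [q] classes of [cl] are translates of the class of 0, which is the maximal ideal; hence its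
   cardinal. *)
- pose cl (t : quotient_ring S) := res (repr t).
  have clE t : dv (proj S pi) 1 t = (cl t == res 0).
    apply/idP/eqP; rewrite -[t in dv _ _ t]reprK.
      by move/(dvE 1%N _ n0) => [w e]; apply/resP; exists w; rewrite subr0 e expr1.
    by move/resP => [w e]; apply/(dvE 1%N _ n0); exists w; rewrite expr1 -e subr0.
  have fib i : #|[pred t | cl t == i]| = #|[pred t | dv (proj S pi) 1 t]|.
    pose f (t : quotient_ring S) := t - proj S (lift i).
    have finj : injective f by apply: addIr.
    rewrite -(fintype.card_image finj); apply: eq_card => t.
    have -> : t = f (t + proj S (lift i)) by rewrite /f addrK.
    rewrite fintype.mem_image // !inE clE; move: (t + _) => {}t.
    apply/eqP/eqP => h.
      apply/resP; have [w e] : exists w, repr t - lift i = pi * w by apply/resP; rewrite liftK.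
      have [v ev] : pidv n (repr (f t) - (repr t - lift i)).
        by apply/SI/projP; rewrite reprK /f rmorphB /= reprK.
      exists (pi ^+ n.-1 * v + w); rewrite mulrDr mulrA -exprS prednK // -ev -e.
      by rewrite subr0 subrK.
    have [w e] : exists w, repr (f t) - 0 = pi * w by apply/resP.
    have [v ev] : pidv n (repr (f t) - (repr t - lift i)).
      by apply/SI/projP; rewrite reprK /f rmorphB /= reprK.
    rewrite -[RHS]liftK; apply/resP; exists (w - pi ^+ n.-1 * v).
    by rewrite mulrBr mulrA -exprS prednK // -ev -e; ring.
  have : (q * #|[pred t | dv (proj S pi) 1 t]| = q * q ^ n.-1)%N.
    rewrite -expnS prednK // -cS -[RHS]sum1_card (partition_big cl xpredT) //=.
    rewrite (eq_bigr (fun=> #|[pred t | dv (proj S pi) 1 t]|)).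
      by rewrite sum_nat_const card_ord.
    by move=> i _; rewrite -(fib i) -sum1_card; apply: eq_bigl => t.
  by move/eqP; rewrite eqn_pmul2l ?(ltnW q1) // => /eqP.
- rewrite -rmorphXn; apply/projP/SI; rewrite subr0; exists 1.
  by rewrite mulr1.
- move=> m k t /andP[km mn]; rewrite -(reprK t) -rmorphXn -rmorphM.
  move=> /(dvE _ _ mn) /(pidv_cancel km) h; apply/dvE => //.
  by rewrite (leq_trans (leq_subr _ _)).
move=> t; rewrite -(reprK t) => nd; have [u|nu] := boolP (repr t \is a GRing.unit).
  by exists (proj S (repr t)^-1); rewrite -rmorphM divrr // rmorph1.
case/negP: nd; apply/(dvE 1%N _ n0); have /nonunitP[y ->] := nu.
by exists y; rewrite expr1.
Qed.

End DVR.

(** * Laws *)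

Local Open Scope classical_set_scope.

Section FiniteLaw.
Context (R : realType) (dO : measure_display) (Omega : measurableType dO).
Variables (P : probability Omega R) (T : finType) (f : Omega -> T).
Hypothesis f_meas : forall t, measurable (f @^-1` [set t]).

Let preimageE (p : pred T) :
  [set w | p (f w)] = \bigcup_(t in [set t | p t]) (f @^-1` [set t]).
Proof.
apply/seteqP; split=> [w pw|w [t pt /= ft] /=]; first by exists (f w).
by rewrite ft.
Qed.

Lemma measurable_finite (p : pred T) : measurable [set w | p (f w)].
Proof.
rewrite preimageE; apply: fin_bigcup_measurable => [|t _]; last exact: f_meas.
exact: (finite_finpred p).
Qed.

Lemma probability_finite (p : pred T) :
  P [set w | p (f w)] = (\sum_(t | p t) P (f @^-1` [set t]))%E.
Proof.
rewrite preimageE measure_fin_bigcup //; last 2 first.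
- exact: (finite_finpred p).
- by apply/trivIsetP => s t _ _ st; apply/seteqP; split=> // w [/= fs ft]; move: st; rewrite -fs ft eqxx.
rewrite (@fsbigE _ _ _ _ _ [seq t <- index_enum T | p t]) /=.
- rewrite big_filter_cond; apply: eq_bigl => t; rewrite andb_idr // => pt.
  by rewrite inE.
- by rewrite filter_uniq // index_enum_uniq.
- by move=> t /=; rewrite mem_filter => /andP[].
- by move=> t /= pt; rewrite mem_filter pt mem_index_enum.
Qed.

End FiniteLaw.

(** * Laws on extended naturals from their tails *)

Section Tails.
Context (R : realType).

Definition enat (v : \bar R) : Prop := v = +oo%E \/ exists n : nat, v = (n%:R)%:E.

Definition tail dO (Omega : measurableType dO) (V : Omega -> \bar R) (n : nat) : set Omega :=
  [set w | ((n%:R)%:E <= V w)%E].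

(** Level 0 is the value [+oo] and level [n.+1] the value [n], so that one sequence lists all
    possible values; [codes] follows the same convention. *)
Definition level dO (Omega : measurableType dO) (V : Omega -> \bar R) (k : nat) : set Omega :=
  if k is n.+1 then tail V n `\` tail V n.+1 else [set w | V w = +oo%E].

Section OneVariable.
Context (dO : measure_display) (Omega : measurableType dO) (V : Omega -> \bar R).
Hypothesis V_nat : forall w, enat (V w).
Hypothesis V_meas : forall n, measurable (tail V n).

Lemma level_succ n w : level V n.+1 w <-> V w = (n%:R)%:E.
Proof.
rewrite /level /tail /=; case: (V_nat w) => [->|[m ->]].
  by split=> [[_]|//]; rewrite leey.
rewrite !lee_fin !ler_nat; split=> [[nm /negP]|[/eqP]].
  by rewrite -ltnNge ltnS => mn; congr (_%:R%:E); lia.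
by rewrite eqr_nat => /eqP ->; split=> //; apply/negP; rewrite -ltnNge.
Qed.

Lemma level_zero : level V 0 = ~` (\bigcup_n level V n.+1).
Proof.
apply/seteqP; split=> w.
  by move=> /= Voo [n _ /level_succ]; rewrite Voo.
by move=> h /=; case: (V_nat w) => // -[n Vn]; case: h; exists n => //; apply/level_succ.
Qed.

Lemma measurable_level k : measurable (level V k).
Proof.
case: k => [|n]; last exact: measurableD.
rewrite level_zero; apply: measurableC; apply: bigcupT_measurable => n.
exact: measurableD.
Qed.

Lemma trivIset_level : trivIset setT (level V).
Proof.
apply/trivIsetP => -[|i] [|j] _ _ // ij; apply/seteqP; split=> // w [].
- by move=> /= Voo /level_succ; rewrite Voo.
- by move=> /level_succ e /= Voo; move: e; rewrite Voo.
- move=> /level_succ ei /level_succ; rewrite ei => -[/eqP]; rewrite eqr_nat => /eqP ij'.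
  by move: ij; rewrite ij' eqxx.
Qed.

Definition codes (S : set (\bar R)) : set nat :=
  [set k | if k is n.+1 then S (n%:R)%:E else S +oo%E].

Lemma preimage_level (S : set (\bar R)) : V @^-1` S = \bigcup_(k in codes S) level V k.
Proof.
apply/seteqP; split=> [w Sw|w [[|n] Sk]].
- case: (V_nat w) => [Voo|[n Vn]].
    by exists 0%N => //=; rewrite -Voo.
  by exists n.+1; [rewrite /= -Vn|apply/level_succ].
- by move=> /= Voo; rewrite /= Voo.
- by move=> /level_succ /= Vn; rewrite /= Vn.
Qed.

Lemma measurable_enat : measurable_fun setT V.
Proof.
move=> _ S _; rewrite setTI preimage_level; apply: bigcup_measurable => k _.
exact: measurable_level.
Qed.

Lemma probability_level_succ (P : probability Omega R) n :
  P (level V n.+1) = (P (tail V n) - P (tail V n.+1))%E.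
Proof.
rewrite /level measureD //; last by rewrite (le_lt_trans (probability_le1 _ _)) ?ltry.
congr (_ - P _)%E; apply/seteqP; split=> [w []//|w h]; split=> //.
by apply: le_trans h; rewrite lee_fin ler_nat.
Qed.

Lemma probability_level_zero (P : probability Omega R) :
  P (level V 0) = (1 - \sum_(0 <= n <oo) P (level V n.+1))%E.
Proof.
rewrite level_zero probability_setC; last first.
  by apply: bigcupT_measurable => n; apply: (measurable_level n.+1).
congr (1 - _)%E; rewrite measure_bigcup.
- by apply: eq_eseriesl => n; rewrite in_setT.
- by move=> n _; apply: (measurable_level n.+1).
apply/trivIsetP => i j _ _ ij.
by have /trivIsetP := trivIset_level; apply.
Qed.

End OneVariable.

(** A finite level is a difference of tails, and the infinite level is the complement of all finite
    ones. *)
Lemma same_law_tails dO (Omega : measurableType dO) dO' (Omega' : measurableType dO')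
    (P : probability Omega R) (P' : probability Omega' R)
    (V : Omega -> \bar R) (Y : Omega' -> \bar R) :
  (forall w, enat (V w)) -> (forall w, enat (Y w)) ->
  (forall n, measurable (tail V n)) -> (forall n, measurable (tail Y n)) ->
  (forall n, P (tail V n) = P' (tail Y n)) -> same_law P P' V Y.
Proof.
move=> Vn Yn Vm Ym VY.
have levE k : P (level V k) = P' (level Y k).
  have succE n : P (level V n.+1) = P' (level Y n.+1).
    by rewrite !probability_level_succ // !VY.
  case: k => [|//]; rewrite !probability_level_zero //; congr (1 - _)%E.
  by apply: eq_eseriesr => n _; exact: succE.
split; [exact: measurable_enat|exact: measurable_enat|move=> S _].
rewrite !preimage_level // !measure_bigcup //.
- by apply: eq_eseriesr => k _; exact: levE.
- by move=> k _; apply: measurable_level.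
- by apply: sub_trivIset (trivIset_level Yn).
- by move=> k _; apply: measurable_level.
- by apply: sub_trivIset (trivIset_level Vn).
Qed.

End Tails.

(** * Uniformizer, digits and valuation *)

Section Valuation.
Variable W : idomainType.

Lemma dvr_uniformizer : is_dvr W -> exists2 pi : W, pi != 0 &
  forall x : W, x \isn't a GRing.unit <-> exists y, x = pi * y.
Proof.
case=> pid idn [x0 x0n x0nu]; have [pi piE] := pid _ idn.
have nuE x : nonunits x <-> exists y, x = pi * y.
  rewrite piE; split=> [[y _ <-]|[y ->]]; first by exists y.
  by exists y.
exists pi => //; apply: contra_neq x0n => pi0.
by have /nuE[y ->] := x0nu; rewrite pi0 mul0r.
Qed.

Lemma residue_system (q : nat) (pi : W) :
  (forall x : W, x \isn't a GRing.unit <-> exists y, x = pi * y) ->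
  (residue_field W #= `I_q)%card ->
  exists (res : W -> 'I_q) (lift : 'I_q -> W), cancel lift res /\
    forall x y, res x = res y <-> exists w, x - y = pi * w.
Proof.
move=> nuP /card_set_bijP[f [ff finj fsurj]].
pose coset (x : W) : set W := [set y | nonunits (y - x)].
have cosetR x : residue_field W (coset x) by exists x.
have flt x : (f (coset x) < q)%N by exact: ff.
pose res x := Ordinal (flt x).
have liftE (i : 'I_q) : {x | res x = i}.
  apply: cid; have [C [x _ xC] fC] := fsurj i (ltn_ord i).
  by exists x; apply/val_inj; rewrite /= -fC -xC.
exists res, (fun i => sval (liftE i)); split=> [i|x y].
  exact: svalP (liftE i).
split=> [/(congr1 val) /= e|[w e]].
  have {}e : coset x = coset y by apply: finj; rewrite ?inE.
  have : coset x x.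
    by apply/nuP; exists 0; rewrite subrr mulr0.
  by rewrite e => /nuP.
apply/val_inj => /=; congr f; apply/seteqP; split=> u /nuP[v ev]; apply/nuP.
  by exists (v + w); rewrite mulrDr -ev -e; ring.
by exists (v - w); rewrite mulrBr -ev -e; ring.
Qed.

Variable pi : W.
Hypothesis nuP : forall x : W, x \isn't a GRing.unit <-> exists y, x = pi * y.

Lemma ideal_pow_nonunits n (x : W) :
  ideal_pow (@nonunits W) n x <-> pidv pi n x.
Proof.
elim: n x => [|n IH] x /=; first by split=> // _; exists x; rewrite mul1r.
split=> [h|[y ->] J [[J0 JD JM] sJ]]; last first.
  apply: sJ; exists pi; first by apply/nuP; exists 1; rewrite mulr1.
  by exists (pi ^+ n * y); [apply/IH; exists y|rewrite mulrA -exprS].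
apply: (h [set y | pidv pi n.+1 y]); split.
  split=> [|a b|a b].
  - by exists 0; rewrite mulr0.
  - exact: pidvD.
  - exact: pidvM.
move=> _ [a /nuP[u ->] [b /IH[v ->] <-]]; exists (u * v).
by rewrite exprS; ring.
Qed.

Lemma pidv_weak m n x : (m <= n)%N -> pidv pi n x -> pidv pi m x.
Proof.
by move=> mn [y ->]; exists (pi ^+ (n - m) * y); rewrite mulrA -exprD subnKC.
Qed.

Variable R : realType.

Lemma valuation_ge (n : nat) (x : W) :
  ((n%:R)%:E <= valuation R x)%E <-> pidv pi n x.
Proof.
split=> [|h]; last first.
  by apply: ereal_sup_ubound; exists n => //; apply/ideal_pow_nonunits.
case: n => [|n] le; first by exists x; rewrite mul1r.
apply: contrapT => h; move: le; apply/negP; rewrite -ltNge.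
apply: (@le_lt_trans _ _ (n%:R)%:E); last by rewrite lte_fin ltr_nat.
apply: ge_ereal_sup => _ [m /ideal_pow_nonunits pm <-].
rewrite lee_fin ler_nat leqNgt; apply/negP => nm; apply: h.
exact: pidv_weak pm.
Qed.

(** An element of every power of the maximal ideal has valuation [+oo]; otherwise the least power
    missing it is its valuation plus one. *)
Lemma valuation_enat (x : W) : enat (valuation R x).
Proof.
have [h|/existsNP h] := pselect (forall n, pidv pi n x).
  left; apply: eq_infty => r; apply: (@le_trans _ _ ((Num.trunc r).+1%:R)%:E).
    by rewrite lee_fin ltW // truncnS_gt.
  exact/valuation_ge.
have {}h : exists n, ~~ `[< pidv pi n x >] by case: h => n hn; exists n; apply/asboolPn.
right; case: (ex_minnP h) => -[|n] /asboolPn hn hmin.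
  by case: hn; exists x; rewrite mul1r.
exists n; apply/eqP; rewrite eq_le; apply/andP; split; last first.
  apply/valuation_ge/asboolP/negPn/negP => /hmin.
  by rewrite ltnn.
apply: ge_ereal_sup => _ [m /ideal_pow_nonunits pm <-].
rewrite lee_fin ler_nat leqNgt; apply/negP => nm; apply: hn.
exact: pidv_weak pm.
Qed.

End Valuation.

(** * Haar measure on finite quotients *)

Section Haar.
Context (W : idomainType) (R : realType) (mu : probability (borel W) R).
Hypothesis haar_mu : is_haar mu.
Variables (pi : W) (N : nat) (S : finite_quotient W).
Hypothesis nuP : forall x : W, x \isn't a GRing.unit <-> exists y, x = pi * y.
Hypothesis SI : forall x, fq_ideal S x <-> pidv pi N x.

Definition ball (t : quotient_ring S) : set (borel W) := [set x | proj S x = t].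

Lemma measurable_ball t : measurable (ball t).
Proof.
apply: sub_sigma_algebra => x xt; exists N => y /(ideal_pow_nonunits nuP) h.
by rewrite /ball /= -[RHS]xt; apply/projP/SI.
Qed.

(** The balls partition [W] and are translates of the ball of 0, so invariance gives them equal
    mass. *)
Lemma haar_ball t : mu (ball t) = ((#|{: quotient_ring S}|%:R)^-1)%:E.
Proof.
have ball0 s : mu (ball s) = mu (ball 0).
  rewrite -(haar_mu (fq_rep s) (measurable_ball 0)); congr (mu _).
  apply/seteqP; split=> [x xs|_ [y y0 <-]] /=.
    exists (x - fq_rep s); last by rewrite addrC subrK.
    by rewrite /ball /= rmorphB /= (reprK s) [X in X - _]xs subrr.
  have {}y0 : proj S y = 0 by exact: y0.
  by rewrite /ball /= rmorphD /= (reprK s) y0 addr0.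
have := @probability_finite R _ _ mu _ (proj S : borel W -> quotient_ring S)
  measurable_ball xpredT.
rewrite (_ : [set w | _] = setT); last by apply/seteqP.
rewrite probability_setT (eq_bigr (fun=> mu (ball 0))) => [|s _]; last exact: ball0.
have muE : mu (ball 0) = (fine (mu (ball 0)))%:E.
  by rewrite fineK // fin_num_measure //; apply: measurable_ball.
rewrite ball0 muE sumEFin sumr_const => -[e]; congr EFin.
have n0 : (#|{: quotient_ring S}|%:R : R) != 0.
  by rewrite pnatr_eq0; apply/eqP => n0; move: e; rewrite n0 mulr0n => /eqP; rewrite oner_eq0.
by apply: (mulIf n0); rewrite mulVf // mulr_natr -e.
Qed.

End Haar.

Section PairLaw.
Context (W : idomainType) (R : realType) (mu : probability (borel W) R).
Hypothesis haar_mu : is_haar mu.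
Variables (pi : W) (N : nat) (S : finite_quotient W).
Hypothesis nuP : forall x : W, x \isn't a GRing.unit <-> exists y, x = pi * y.
Hypothesis SI : forall x, fq_ideal S x <-> pidv pi N x.
Context (dO : measure_display) (Omega : measurableType dO) (P : probability Omega R).
Variables (d j : nat) (A B : Omega -> {poly W}).
Hypothesis haarAB : haar_monic_pair d mu P A B.
Hypothesis jd : (j <= d)%N.
Local Notation T := (quotient_ring S).
Local Notation dv := (dv (proj S pi)).

Definition reduced_pair (w : Omega) : pairs T d :=
  ([tuple proj S (A w)`_i | i < d], [tuple proj S (B w)`_i | i < d]).

Let box (t : pairs T d) (i : 'I_(d + d)) : set (borel W) :=
  match fintype.split i with
  | inl k => ball (tnth t.1 k)
  | inr k => ball (tnth t.2 k)
  end.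

Let measurable_box t i : measurable (box t i).
Proof. by rewrite /box; case: fintype.split => k; apply: measurable_ball nuP SI _. Qed.

Let reduced_pairE t : reduced_pair @^-1` [set t] =
  [set w | forall i, box t i (tnth (pair_coefs d (A w) (B w)) i)].
Proof.
apply/seteqP; split=> [w <- i|w h] /=.
  rewrite tnth_mktuple /box; case: fintype.split => k;
  by rewrite /ball /= tnth_mktuple.
rewrite [t]surjective_pairing /reduced_pair; congr pair; apply/eq_from_tnth => k;
  rewrite tnth_mktuple.
  have := h (unsplit (inl k)); rewrite tnth_mktuple /box unsplitK.
  by [].
have := h (unsplit (inr k)); rewrite tnth_mktuple /box unsplitK.
by [].
Qed.

Let measurable_reduced_pair t : measurable (reduced_pair @^-1` [set t]).
Proof.
have [_ _ /measurable_fun_tnthP mAB _] := haarAB.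
rewrite reduced_pairE [X in measurable X](_ : _ = \bigcap_(i in [set: 'I_(d + d)])
  ((fun w => tnth (pair_coefs d (A w) (B w)) i) @^-1` box t i)).
  apply: fin_bigcap_measurable => [|i _]; first by apply: sub_finite_set (finite_finpred predT) => i.
  by rewrite -[X in measurable X]setTI; apply: mAB.
by apply/seteqP; split=> [w h i _|w h i] //; apply: h.
Qed.

Let probability_reduced_pair t :
  P (reduced_pair @^-1` [set t]) = (((#|{: T}|%:R ^+ d) ^+ 2)^-1)%:E.
Proof.
have [_ _ _ PS] := haarAB; rewrite reduced_pairE PS //.
rewrite (eq_bigr (fun=> ((#|{: T}|%:R)^-1)%:E)) => [|i _]; last first.
  by rewrite /box; case: fintype.split => k; apply: haar_ball nuP SI _.
rewrite prodEFin prodr_const card_ord; congr EFin.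
by rewrite -exprM muln2 -addnn exprVn.
Qed.

Let map_mpoly (p : {poly W}) : p \is monic -> size p = d.+1 ->
  map_poly (proj S) p = mpoly d [tuple proj S p`_i | i < d].
Proof.
move=> pm sp; rewrite -[LHS](@mpoly_ptuple _ d).
- by congr mpoly; apply: eq_map => i; rewrite coef_map.
- exact: monic_map.
- by rewrite size_map_poly_id0 // (eqP pm) rmorph1 oner_neq0.
Qed.

Let proj_subresultant w : proj S (subresultant d j (A w) (B w)) =
  \det (sylvester_mx d j (mpoly d (reduced_pair w).1) (mpoly d (reduced_pair w).2)).
Proof.
have [Am Bm _ _] := haarAB; have [Amw sA] := Am w; have [Bmw sB] := Bm w.
rewrite /= -!map_mpoly // /subresultant -det_map_mx; congr (\det _).
rewrite /subresultant_mx /sylvester_mx map_row_mx; congr row_mx;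
  by apply/matrixP => r c; rewrite !mxE -coef_map rmorphM /= map_polyXn.
Qed.

(** Passes from coordinates [(A, C)] to [(A, B)] with [B = A + C]; being a bijection, it preserves
    counts. *)
Let add_pair (x : pairs T d) : pairs T d := (x.1, [tuple x.2`_i + x.1`_i | i < d]).

Let add_pair_inj : injective add_pair.
Proof.
move=> [a b] [a' b'] [<- /= h]; congr pair; apply/eq_from_tnth => i.
have {}h : [tuple b`_k + a`_k | k < d] = [tuple b'`_k + a`_k | k < d].
  by apply/val_inj.
have := congr1 (fun t => tnth t i) h; rewrite !tnth_mktuple => /addIr.
by rewrite -!tnth_nth.
Qed.

Let mpoly_add_pair x :
  mpoly d (add_pair x).2 = mpoly d (add_pair x).1 + Poly x.2.
Proof.
rewrite /mpoly /= -addrA; congr (_ + _); apply/polyP => i.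
rewrite coefD !coef_Poly; have [id|di] := ltnP i d.
  by rewrite -[i]/(val (Ordinal id)) nth_mktuple addrC.
by rewrite !nth_default ?size_tuple ?card_ord ?addr0.
Qed.

Lemma probability_tail_valuation n : (n <= N)%N ->
  measurable (tail (fun w => valuation R (subresultant d j (A w) (B w))) n) /\
  P (tail (fun w => valuation R (subresultant d j (A w) (B w))) n) =
  (pair_density (proj S pi) R d (d - j) n)%:E.
Proof.
move=> nN; pose p (t : pairs T d) :=
  dv n (\det (sylvester_mx d j (mpoly d t.1) (mpoly d t.2))).
have -> : tail (fun w => valuation R (subresultant d j (A w) (B w))) n =
    [set w | p (reduced_pair w)].
  apply/seteqP; split=> w /=; rewrite /p -proj_subresultant.
    by move/(valuation_ge nuP) => h; apply/(quotient_dvP _ SI).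
  by move/(quotient_dvP _ SI nN) => h; apply/(valuation_ge nuP).
split; first exact: measurable_finite.
rewrite probability_finite //.
rewrite (eq_bigr (fun=> (((#|{: T}|%:R ^+ d) ^+ 2)^-1)%:E)) => [|t _]; last first.
  exact: probability_reduced_pair.
rewrite sumEFin sumr_const -[X in X%:E = _]mulr_natl /pair_density.
congr EFin; congr (_ * _); congr (_%:R).
transitivity #|[pred x : pairs T d | p (add_pair x)]|.
  by symmetry; exact: (card_preim_inj p add_pair_inj).
apply: eq_card => x; rewrite !inE /p mpoly_add_pair.
have am := mpoly_monic (add_pair x).1.
have sB : (size (mpoly d (add_pair x).1 + Poly x.2)%R <= d.+1)%N.
  rewrite (leq_trans (size_polyD _ _)) // geq_max size_mpoly leqnn /=.
  by rewrite leqW // size_Poly_tuple.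
(* The sign is a unit, and [A + C] has the moments of [C] because multiples of [A] have no
   residue. *)
have [b ->] := det_sylvester jd am (size_mpoly _) sB.
rewrite (@dv_unit _ _ _ _ ((-1) ^+ b)); last by rewrite -expr2 sqrr_sign.
congr (dv n (\det _)); apply: eq_hankel => i _.
by rewrite /moment mulrDr residue_addl_mul.
Qed.

End PairLaw.

Section SumOfMins.

Lemma wmin_cap N a b y : wmin N a b (fun l => minn (y l) N) = wmin N a b y.
Proof.
rewrite /wmin; elim: (index_iota a b) => [|x s IH]; first by rewrite !big_nil.
rewrite !big_cons IH; have : (\big[minn/N]_(l <- s) y l <= N)%N.
  by elim: s {IH} => [|i s IH]; rewrite ?big_nil // big_cons geq_min IH orbT.
by lia.
Qed.

Lemma wmin_widen N B a b y : (N <= B)%N -> wmin N a b y = minn N (wmin B a b y).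
Proof.
move=> NB; rewrite /wmin; elim: (index_iota a b) => [|x s IH].
  by rewrite !big_nil; lia.
by rewrite !big_cons IH; lia.
Qed.

Lemma wmin_attained B a b y : (a < b)%N -> (forall l, y l <= B)%N ->
  exists2 l, (a <= l < b)%N & wmin B a b y = y l.
Proof.
move=> ab yB; suff : forall s, s != [::] ->
    exists2 l, l \in s & \big[minn/B]_(l <- s) y l = y l.
  move=> /(_ (index_iota a b)) [|l].
    by rewrite -size_eq0 size_iota subn_eq0 -ltnNge.
  by rewrite mem_index_iota => lab e; exists l.
elim=> // x s IH _; rewrite big_cons; have [->|s0] := eqVneq s [::].
  by exists x; rewrite ?mem_seq1 // big_nil; have := yB x; lia.
have [l ls ->] := IH s0; have [xl|lx] := leqP (y x) (y l).
  by exists x; rewrite ?mem_head.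
by exists l => //; rewrite inE ls orbT.
Qed.

Lemma leq_ysum_cap N B n d e y : (n <= N)%N -> (N <= B)%N ->
  (n <= ysum N d e (fun l => minn (y l) N))%N = (n <= ysum B d e y)%N.
Proof.
move=> nN NB; rewrite /ysum.
under eq_bigr => i _ do rewrite wmin_cap (wmin_widen _ _ _ NB).
exact: leq_sum_cap.
Qed.

Context (R : realType) (dO : measure_display) (Omega : measurableType dO).

Definition rev_family (d : nat) (X : 'I_d -> Omega -> nat) (w : Omega) (l : nat) : nat :=
  if insub l is Some k then X (rev_ord k) w else 0.

Lemma extend_rev_family d (X : 'I_d -> Omega -> nat) w (l : nat) : (l < d)%N ->
  extend_family R X (d.-1 - l)%N w = ((rev_family X w l)%:R)%:E.
Proof.
move=> ld; have h : (d.-1 - l < d)%N by lia.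
rewrite /extend_family /rev_family !insubT /=; congr EFin; congr (_%:R).
by congr (X _ w); apply/val_inj => /=; lia.
Qed.

(** A window with [i >= d - j] contains the index [d], where the variable is 0. A smaller one stays
    below [d], and its negative indices, of value [+oo], correspond to the cut at [d] in [ysum]. As
    [B] bounds the values at [w], the cap has no effect. *)
Lemma sum_of_minsE d (j : 'I_d) (X : 'I_d -> Omega -> nat) w B :
  (forall l, rev_family X w l <= B)%N ->
  sum_of_mins R j X w = ((ysum B d (d - j) (rev_family X w))%:R)%:E.
Proof.
move=> yB; rewrite /sum_of_mins; set e := (d - j)%N; have jd := ltn_ord j.
have ge0 i : (0 <= extend_family R X i w)%E.
  by case: i => [m|m] /=; [case: insub => [k|]|]; rewrite ?leey // lee_fin.
have large (i : 'I_d.+1) : (e <= i)%N ->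
    \big[Order.min/+oo%E]_(k < (i + i).+1) extend_family R X (j%:Z - i%:Z + k%:Z)%R w = 0%E.
  move=> ei; apply/eqP; rewrite eq_le; apply/andP; split; last first.
    by elim/big_ind: _ => [|a b a0 b0|k _]; rewrite ?leey // le_min a0.
  have kP : (d + i - j < (i + i).+1)%N by rewrite /e in ei; have := ltn_ord i; lia.
  apply: (bigmin_inf (Ordinal kP)) => //=.
  rewrite (_ : j%:Z - i%:Z + (d + i - j)%N%:Z = d%:Z :> int)%R; last by lia.
  by rewrite /= insubF ?ltnn.
have small (i : nat) : (i < e)%N ->
    \big[Order.min/+oo%E]_(k < (i + i).+1) extend_family R X (j%:Z - i%:Z + k%:Z)%R w =
    ((wmin B (e - i.+1) (minn d (e + i)) (rev_family X w))%:R)%:E.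
  move=> ie; apply/eqP; rewrite eq_le; apply/andP; split.
    have [|l /andP[l1 l2] ->] := @wmin_attained B (e - i.+1) (minn d (e + i)) _ _ yB.
      by rewrite /e in ie *; lia.
    have ld : (l < d)%N by lia.
    have kP : (e.-1 + i - l < (i + i).+1)%N by lia.
    apply: (bigmin_inf (Ordinal kP)) => //=; rewrite -extend_rev_family //.
    by rewrite (_ : j%:Z - i%:Z + (e.-1 + i - l)%N%:Z = (d.-1 - l)%N%:Z :> int)%R //;
      rewrite /e in l1 l2 ie *; lia.
  elim/big_ind: _ => [|a b a0 b0|k _]; rewrite ?leey //; first by rewrite le_min a0.
  case E : (j%:Z - i%:Z + k%:Z)%R => [m|m]; last by rewrite leey.
  have kk := ltn_ord k; have md : (m < d)%N by rewrite /e in ie; lia.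
  rewrite (_ : m = d.-1 - (d.-1 - m))%N; last by lia.
  rewrite extend_rev_family; last by lia.
  by rewrite lee_fin ler_nat wmin_le // /e in ie *; lia.
rewrite (bigID (fun i : 'I_d.+1 => i < e)%N) /= [X in (_ + X)%E]big1; last first.
  by move=> i; rewrite -leqNgt => ei; apply: large.
rewrite adde0 /ysum natr_sum -sumEFin.
rewrite (@big_ord_widen _ _ _ e d.+1
  (fun i => ((wmin B (e - i.+1) (minn d (e + i)) (rev_family X w))%:R)%:E)); last first.
  by rewrite /e; lia.
by apply: eq_bigr => i ie; apply: small.
Qed.

End SumOfMins.

(** * Geometric variables as valuations of uniform elements *)

Section WindowLaw.
Context (R : realType) (T : finComNzRingType) (pi : T) (N q : nat).
Hypothesis RC : chain_ring pi N q.
Context (dO : measure_display) (Omega : measurableType dO) (P : probability Omega R).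
Variables (d : nat) (X : 'I_d -> {RV P >-> nat}).
Hypothesis indepX : mutually_independent X.
Hypothesis geomX : forall i, geometric_law q (X i).
Local Notation z := (q%:R^-1 : R).
Local Notation M := (#|T|%:R : R).

Let measurable_X i (D : set nat) : measurable (X i @^-1` D).
Proof. exact: measurable_funPTI. Qed.

Lemma geometric_tail i k : P (X i @^-1` [set m | (k <= m)%N]) = (z ^+ k)%:E.
Proof.
elim: k => [|k IH].
  by rewrite (_ : _ @^-1` _ = setT) ?probability_setT //; apply/seteqP.
have E : X i @^-1` [set m | (k <= m)%N] =
    X i @^-1` [set k] `|` X i @^-1` [set m | (k < m)%N].
  apply/seteqP; split=> [w /=|w [/= ->|/= /ltnW]] //.
  by rewrite leq_eqVlt => /orP[/eqP->|]; [left|right].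
have h : (P (X i @^-1` [set k]) + P (X i @^-1` [set m | (k < m)%N]) = (z ^+ k)%:E)%E.
  rewrite -IH E [RHS]measureU //.
  by apply/seteqP; split=> // w [/= ->]; rewrite ltnn.
have e1 : P (X i @^-1` [set k]) = ((1 - z) * z ^+ k)%:E := geomX i k.
have e2 : P (X i @^-1` [set m | (k < m)%N]) =
    (fine (P (X i @^-1` [set m | (k < m)%N])))%:E by rewrite fineK // fin_num_measure.
move: h; rewrite e1 e2.
by rewrite -EFinD => -[e]; congr EFin; rewrite exprS; move: e; lra.
Qed.

Lemma card_dv k : (k <= N)%N -> #|[pred x | dv pi k x]|%:R / M = z ^+ k.
Proof.
have M0 := M_neq0 RC R; have q0 := q_neq0 RC R; elim: k => [|k IH] kN.
  by rewrite expr0 (eq_card (B := T)) ?divff // => x; rewrite !inE dv0.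
have E : #|[pred x | dv pi k x]| = (q * #|[pred x | dv pi k.+1 x]|)%N.
  rewrite -(sum_nat_of_bool (dv pi k)) -(sum_nat_of_bool (dv pi k.+1)).
  transitivity (\sum_x (dv pi k.+1 (pi * x)%R : nat))%N.
    by apply: eq_bigr => x _; rewrite -[pi in pi * x]expr1 (dv_pi RC) // subn1.
  rewrite (sum_mul_pi RC (fun x => dv pi k.+1 x : nat)); congr (_ * _)%N.
  rewrite [RHS](bigID (dv pi 1)) /= [X in (_ + X)%N]big1 ?addn0 // => x nx.
  apply/eqP; rewrite eqb0; apply: contra nx => /dvP[y ->].
  by rewrite exprS -mulrA; apply/dvP; exists (pi ^+ k * y); rewrite expr1.
by rewrite exprS -(IH (ltnW kN)) E natrM; field; rewrite M0 q0.
Qed.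

(** The value [N] collects the whole geometric tail and, in the ring, only the element 0; both have
    mass [q^-N]. *)
Lemma geometric_rval i (t : nat) : (t <= N)%N ->
  P (X i @^-1` [set m | minn m N = t]) =
  (#|[pred x | rval pi N x == t]|%:R / M)%:E.
Proof.
rewrite leq_eqVlt => /orP[/eqP->|tN].
  rewrite (_ : [set m | _] = [set m | (N <= m)%N]); last first.
    by apply/seteqP; split=> m /=; lia.
  rewrite geometric_tail -card_dv //; congr (_%:R / _)%:E; apply: eq_card => x.
  by rewrite !inE -(@leq_rval _ _ N) // eqn_leq rval_le.
rewrite (_ : [set m | _] = [set t]); last by apply/seteqP; split=> m /=; lia.
rewrite [LHS](geomX i t); congr EFin.
have : #|[pred x | dv pi t x]| =
    (#|[pred x | rval pi N x == t]| + #|[pred x | dv pi t.+1 x]|)%N.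
  rewrite -(sum_nat_of_bool (dv pi t)) -(sum_nat_of_bool (dv pi t.+1)).
  rewrite -(sum_nat_of_bool (fun x => rval pi N x == t)) -big_split /=.
  apply: eq_bigr => x _; rewrite -!(@leq_rval _ _ N) // ?(ltnW tN) // leq_eqVlt eq_sym.
  by have [->|] := eqVneq; rewrite ?ltnn.
move/(congr1 (fun n => n%:R / M : R)); rewrite natrD mulrDl !card_dv ?(ltnW tN) //.
by move=> /eqP; rewrite -subr_eq => /eqP <-; rewrite exprS; ring.
Qed.

Let capped (w : Omega) : d.-tuple 'I_N.+1 :=
  [tuple inord (minn (X (rev_ord l) w) N) | l < d].

Let slice (t : d.-tuple 'I_N.+1) (i : 'I_d) : set nat :=
  [set m | minn m N = tnth t (rev_ord i)].

Let cappedE t : capped @^-1` [set t] =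
  \bigcap_(i in [set` [set: 'I_d]%SET]) (X i @^-1` slice t i).
Proof.
apply/seteqP; split=> [w <- i _|w h] /=.
  by rewrite /slice /= tnth_mktuple rev_ordK inordK // ltnS geq_minr.
apply/eq_from_tnth => i; rewrite tnth_mktuple; apply/val_inj => /=.
have := h (rev_ord i); rewrite /slice /= rev_ordK inordK ?ltnS ?geq_minr //.
by apply; rewrite inE.
Qed.

Let measurable_capped t : measurable (capped @^-1` [set t]).
Proof.
rewrite cappedE; apply: fin_bigcap_measurable => [|i _]; last exact: measurable_X.
exact: finite_finpred.
Qed.

Let probability_capped t : P (capped @^-1` [set t]) =
  (\prod_(i < d) (#|[pred x | rval pi N x == tnth t i]|%:R / M))%:E.
Proof.
rewrite cappedE indepX -prodEFin (reindex_inj rev_ord_inj) /=.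
apply: eq_big => [i|i _]; first by rewrite inE.
by rewrite /slice geometric_rval ?rev_ordK // -ltnS.
Qed.

Let capped_rval (y : d.-tuple T) : d.-tuple 'I_N.+1 :=
  [tuple inord (rval pi N (tnth y i)) | i < d].

Let card_capped_rval (p : pred (d.-tuple 'I_N.+1)) :
  #|[pred y | p (capped_rval y)]|%:R / M ^+ d =
  \sum_(t | p t) \prod_(i < d) (#|[pred x | rval pi N x == tnth t i]|%:R / M).
Proof.
rewrite -sum1_card (partition_big capped_rval p) //= natr_sum mulr_suml.
apply: eq_bigr => t pt; rewrite big_split /= prodr_const card_ord exprVn.
congr (_ / _); rewrite -natr_prod; congr (_%:R).
have -> : (\prod_(i < d) #|[pred x | rval pi N x == tnth t i]| =
    #|[pred y : d.-tuple T |
        [forall i : 'I_d, rval pi N (nth 0%R y i) == nth ord0 t i]]|)%N.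
  rewrite (@card_tuple_forall T 0 d (fun i x => rval pi N x == nth ord0 t i :> nat)).
  by apply: eq_bigr => i _; apply: eq_card => x; rewrite !inE (tnth_nth ord0).
rewrite sum1_card; apply: eq_card => y; rewrite !inE.
apply/andP/forallP => [[_ /eqP <-] i|h].
  by rewrite -!tnth_nth tnth_mktuple inordK // ltnS rval_le.
have e : capped_rval y = t; last by rewrite inE e.
apply/eq_from_tnth => i; apply/val_inj; rewrite tnth_mktuple /= inordK ?ltnS ?rval_le //.
by have /eqP := h i; rewrite -!tnth_nth.
Qed.

Lemma probability_tail_window (j : 'I_d) n : (n <= N)%N ->
  measurable (tail (sum_of_mins R j X) n) /\
  P (tail (sum_of_mins R j X) n) = (window_density pi N R d (d - j) n)%:E.
Proof.
move=> nN; pose p (t : d.-tuple 'I_N.+1) :=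
  (n <= ysum N d (d - j) (fun l => nth ord0 t l))%N.
have -> : tail (sum_of_mins R j X) n = [set w | p (capped w)].
  apply/funext => w; rewrite /tail /=; apply: congr1.
  (* The bound must dominate all the variables, for [sum_of_minsE], and [N], for the comparison with
     the sum capped at [N]. *)
  have yB l : (rev_family X w l <= N + \sum_i X i w)%N.
    rewrite /rev_family; case: insubP => [k _ _|//].
    by rewrite (bigD1 (rev_ord k)) //= addnCA leq_addr.
  rewrite (sum_of_minsE R j yB) lee_fin ler_nat -(@leq_ysum_cap N) ?leq_addr //.
  congr (_ <= _)%N; apply: eq_ysum => l ll; have ld : (l < d)%N by lia.
  rewrite -[in RHS](_ : val (Ordinal ld) = l) // nth_mktuple inordK ?ltnS ?geq_minr //.
  by rewrite /rev_family insubT.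
split; first exact: measurable_finite.
rewrite probability_finite //.
rewrite (eq_bigr (fun t : d.-tuple 'I_N.+1 => (\prod_(i < d)
   (#|[pred x | rval pi N x == tnth t i]|%:R / M))%:E)) => [|t _]; last first.
  exact: probability_capped.
rewrite sumEFin -card_capped_rval; congr (_%:R / _)%:E; apply: eq_card => y.
rewrite !inE /p; congr (_ <= _)%N; apply: eq_ysum => l ll; have ld : (l < d)%N by lia.
rewrite -[in LHS](_ : val (Ordinal ld) = l) // nth_mktuple inordK ?ltnS ?rval_le //.
by rewrite /rvals (tnth_nth 0).
Qed.

End WindowLaw.

Theorem theorem3p3
  (R : realType) (W : idomainType) (q : nat)
  (dvrW : is_dvr W) (completeW : adic_complete W)
  (card_residue : (residue_field W #= `I_q)%card)
  (mu : probability (borel W) R) (haar_mu : is_haar mu)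
  (d : nat) (d_ge1 : (1 <= d)%N)
  (dO : measure_display) (Omega : measurableType dO) (P : probability Omega R)
  (A B : Omega -> {poly W}) (haarAB : haar_monic_pair d mu P A B)
  (j : 'I_d)
  (dO' : measure_display) (Omega' : measurableType dO')
  (P' : probability Omega' R) (X : 'I_d -> {RV P' >-> nat})
  (indepX : mutually_independent X)
  (geomX : forall i, geometric_law q (X i)) :
  same_law P P'
    (fun w => valuation R (subresultant d j (A w) (B w)))
    (sum_of_mins R j X).
Proof.
have [pi pi_neq0 nuP] := dvr_uniformizer dvrW.
have [res [lift [liftK resP]]] := residue_system nuP card_residue.
(* For the tail at [n] the quotient by [pi^(n+1)] suffices: its length is positive and at least
   [n]. *)
have tails n :
    [/\ measurable (tail (fun w => valuation R (subresultant d j (A w) (B w))) n),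
        measurable (tail (sum_of_mins R j X) n) &
        P (tail (fun w => valuation R (subresultant d j (A w) (B w))) n) =
        P' (tail (sum_of_mins R j X) n)].
  have [S [SI cS]] := finite_quotient_exists pi_neq0 nuP liftK resP (ltn0Sn n).
  have RC := quotient_chain_ring pi_neq0 nuP liftK resP (ltn0Sn n) SI cS.
  have [mV PV] := probability_tail_valuation haar_mu nuP SI haarAB
    (ltnW (ltn_ord j)) (leqnSn n).
  have [mY PY] := probability_tail_window RC indepX geomX j (leqnSn n).
  split=> //; rewrite PV PY (pair_density_window RC) ?leq_subr //.
apply: same_law_tails.
- by move=> w; apply: valuation_enat nuP _ _.
- move=> w; right.
  have yB l : (rev_family X w l <= \sum_i X i w)%N.
    rewrite /rev_family; case: insubP => [k _ _|//].
    by rewrite (bigD1 (rev_ord k)) //= leq_addr.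
  by exists (ysum (\sum_i X i w) d (d - j) (rev_family X w)); apply: sum_of_minsE.
- by move=> n; case: (tails n).
- by move=> n; case: (tails n).
- by move=> n; case: (tails n).
Qed.
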